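(* (i) Let $(\mathbb{Z},\mathbf{c}_1)$ and $(\mathbb{Z},\mathbf{c}_2)$ be any two networks on $\mathbb{Z}$ (nearest-neighbour edges) such that $(\mathbb{Z},\mathbf{c}_2)$ is recurrent. Then almost surely, all disordered random networks $(\mathbb{Z},\mathbf{c}_1,\mathbf{c}_2,p)$ with $p\in[0,1)$ are recurrent. (ii) Let $G$ be a Cayley graph of $\mathbb{Z}$ with edge set $E$, and let $(G,\mathbf{c}_1)$ and $(G,\mathbf{c}_2)$ be two networks with $\sup_{e\in E}\mathbf{c}_2(e)<\infty$. Then almost surely, all $(G,\mathbf{c}_1,\mathbf{c}_2,p)$ with $p\in[0,1)$ are recurrent. (iii) Let $G$ be a finite connected graph, and let $(\mathbb{Z}\times G,\mathbf{c}_1)$ and $(\mathbb{Z}\times G,\mathbf{c}_2)$ be two connected networks such that $\mathbf{c}_1$ and $\mathbf{c}_2$ are positive functions and such that the network on $\mathbb{Z}$ with conductance function $$\mathbf{c}_2'(\{x,x+1\})=\max_{y\in G}\mathbf{c}_2\left(\{(x,y),(x+1,y)\}\right),\quad x\in\mathbb{Z},$$ is recurrent. Then almost surely, for every $p\in[0,1)$, $(\mathbb{Z}\times G,\mathbf{c}_1,\mathbf{c}_2,p)$ is recurrent. (iv) Let $\Gamma$ be a finite extension of the group $\mathbb{Z}$ (i.e. $\Gamma$ is virtually $\mathbb{Z}$) and $G$ a Cayley graph of $\Gamma$ with edge set $E$. Let $(G,\mathbf{c}_1)$ and $(G,\mathbf{c}_2)$ be two connected networks such that $\mathbf{c}_1$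 and $\mathbf{c}_2$ are positive functions and $\sup_{e\in E}\mathbf{c}_2(e)<\infty$. Then almost surely, all $(G,\mathbf{c}_1,\mathbf{c}_2,p)$ with $p\in[0,1)$ are recurrent.
   Context: A network $(G,\mathbf{c})$ is a graph $G=(V,E)$ with a conductance function $\mathbf{c}:E\to[0,\infty)$; its random walk moves from $x$ to a neighbour $y$ with probability $\mathbf{c}(\{x,y\})/\sum_{e\ni x}\mathbf{c}(e)$. The network is recurrent (transient) if this random walk is recurrent (transient). Conductances may vanish; a connected component of the network means a connected component of the graph on $V$ formed by the edges of positive conductance, and a disconnected network is recurrent if the random walk on each of its connected components is recurrent (finite components, including isolated vertices, being trivially recurrent). Grand coupling: let $(U_e)_{e\in E}$ be i.i.d. uniform on $[0,1]$. For $p\in[0,1]$, edge $e$ is open in Bernoulli-$p$ bond percolation $\omega_p$ if $U_e\le p$ and closed otherwise. The disordered random network $(G,\mathbf{c}_1,\mathbf{c}_2,p)$ is the random network on $G$ in which every open edge $e$ of $\omega_p$ has conductance $\mathbf{c}_1(e)$ and every closed edge $e$ has conductance $\mathbf{c}_2(e)$; all $p\in[0,1]$ are realized on the same probability space via $(U_e)$. $\mathbb{Z}\times G$ is the Cartesian product graph: $(x,y)\sim(x',y')$ iff either $|x-x'|=1$ and $y=y'$, or $x=x'$ and $y\sim y'$ in $G$. A group $\Gamma$ is a finite extension of $\mathbb{Z}$ (virtually $\mathbb{Z}$) if it contains a subgroup isomorphic to $\mathbb{Z}$ of finite index (this includes every $\Gamma$ having a finite normal subgroup $Q$ with $\Gamma/Q\cong\mathbb{Z}$).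 Cayley graphs are with respect to finite generating sets. *)

(* Defs.v *)
From HB Require Import structures.
From mathcomp Require Import all_boot all_order all_algebra finmap.
From mathcomp Require Import all_classical all_reals all_analysis.

Set Implicit Arguments.
Unset Strict Implicit.
Unset Printing Implicit Defensive.

Import Order.TTheory GRing.Theory Num.Theory.
Import numFieldNormedType.Exports.

Local Open Scope classical_set_scope.
Local Open Scope ring_scope.

(* A graph on [V] is given by a symmetric irreflexive relation [adj : rel V].  An
   edge is the unordered pair [[set x; y] : set V], so families indexed by edges
   (conductances, uniform labels) are functions on [set V] of which only the
   values on [edges adj] matter. *)
Section Network.
Context (R : realType) (V : choiceType) (adj : rel V).
Implicit Types (c : set V -> R) (x y : V) (s : seq V).

Definition edges : set (set V) := [set [set z.1; z.2] | z in [set z | adj z.1 z.2]].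

Definition conductance c := forall e, edges e -> 0 <= c e.

Definition positive_conductance c := forall e, edges e -> 0 < c e.

(* A finitely supported sum; it has its intended value on locally finite
   graphs. *)
Definition vertex_weight c x : R :=
  \sum_(e \in [set e | edges e /\ e x]) c e.

Definition step_prob c x y : R :=
  if adj x y then c [set x; y] / vertex_weight c x else 0.

Definition connected_network c := forall x y,
  exists2 s, path (fun u v => adj u v && (0 < c [set u; v])) x s & last x s = y.

Fixpoint traj_prob c x s : R :=
  if s is y :: s' then step_prob c x y * traj_prob c y s' else 1.

(* The probability that the walk started at [x] ever returns to [x]: the event
   is the disjoint union, over the finite sequences [s] avoiding [x], of the
   events that the walk starts with [x :: rcons s x]; see [return_probE]. *)
Definition return_prob c x : \bar R :=
  (\esum_(s in [set s : seq V | x \notin s]) (traj_prob c x (rcons s x))%:E)%E.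

(* The walk started at [x] stays in the connected component of [x] in the graph
   of edges of positive conductance, so this says that the walk is recurrent on
   each component; the vertices of zero weight, at which no walk is defined, are
   the isolated ones. *)
Definition recurrent c := forall x,
  0 < vertex_weight c x -> return_prob c x = 1%E.

End Network.

Section RandomWalk.
Context (R : realType) (V : countType) (adj : rel V).
Context d (T : measurableType d) (P : probability T R).

Definition random_walk (c : set V -> R) (x : V) (X : nat -> T -> V) :=
  (forall n v, measurable (X n @^-1` [set v])) /\
  forall s : seq V, P [set t | mkseq (X ^~ t) (size s).+1 = x :: s] =
                    (traj_prob adj c x s)%:E.

Lemma return_probE (c : set V -> R) (x : V) (X : nat -> T -> V) :
  random_walk c x X ->
  P [set t | exists n, X n.+1 t = x] = return_prob adj c x.
Proof.
move=> [mX Xlaw].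
pose cyl s := [set t | mkseq (X ^~ t) (size s) = s].
have mcyl s : measurable (cyl s).
  have -> : cyl s = \bigcap_(i in `I_(size s)) (X i @^-1` [set nth x s i]).
    apply/seteqP; split => t /=.
      by move=> <- i /=; rewrite size_mkseq => ilt; rewrite nth_mkseq.
    move=> H; apply: (@eq_from_nth _ x); rewrite size_mkseq // => i ilt.
    by rewrite nth_mkseq //; exact: H.
  by apply: fin_bigcap_measurable => // i _; exact: mX.
have mkseqSl (f : nat -> V) n : mkseq f n.+1 = f 0%N :: mkseq (f \o succn) n.
  by rewrite /mkseq /= -[1%N]addn0 iotaDl -map_comp.
pose A s := cyl (x :: rcons s x).
pose D := [set s : seq V | x \notin s].
pose F (n : nat) : set T := if @pickle_inv (seq V) n is Some s then
    (if x \notin s then A s else set0) else set0.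
have mF n : measurable (F n).
  rewrite /F; case: pickle_inv => [s|]; last exact: measurable0.
  by case: ifP => _; [exact: mcyl | exact: measurable0].
have AP s t : A s t ->
    [/\ X 0%N t = x, s = mkseq (fun i => X i.+1 t) (size s) & X (size s).+1 t = x].
  rewrite /A /cyl /= size_rcons mkseqSl mkseqS => -[-> /rcons_inj[H1 H2]].
  by split; [|rewrite H1|].
have Auniq s s' t : x \notin s -> x \notin s' -> A s t -> A s' t -> s = s'.
  move=> xs xs' /AP[_ sE sx] /AP[_ s'E s'x].
  have lt_contra (r r' : seq V) : r' = mkseq (fun i => X i.+1 t) (size r') ->
      X (size r).+1 t = x -> x \notin r' -> ~ (size r < size r')%N.
    move=> -> rx /negP + lt; apply; apply/mapP; exists (size r) => //.
    by rewrite mem_iota /= add0n; move: lt; rewrite size_mkseq.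
  suff ss : size s = size s' by rewrite sE s'E ss.
  case: (ltngtP (size s) (size s')) => // h.
    by case: (lt_contra s s').
  by case: (lt_contra s' s).
have tF : trivIset setT F.
  move=> i j _ _ [t []]; rewrite /F.
  case ui : (pickle_inv i) => [s|//]; case uj : (pickle_inv j) => [s'|//].
  case: ifPn => // xs; case: ifPn => // xs' As As'.
  have := @pickle_invK (seq V) i; have := @pickle_invK (seq V) j.
  by rewrite ui uj /= (Auniq _ _ _ xs xs' As As') => -> ->.
have FE : [set t | X 0%N t = x] `&` [set t | exists n, X n.+1 t = x] = \bigcup_n F n.
  apply/seteqP; split => t /=.
    move=> [X0 ex].
    have ex' : exists n, X n.+1 t == x by case: ex => n /eqP; exists n.
    case: (ex_minnP ex') => n /eqP Xn nmin.
    pose s := mkseq (fun i => X i.+1 t) n.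
    have xs : x \notin s.
      apply/negP => /mapP[i]; rewrite mem_iota add0n /= => ilt xi.
      by have := nmin i; rewrite -xi eqxx leqNgt ilt => /(_ isT).
    exists (choice.pickle s) => //; rewrite /F pickleK_inv xs /A /cyl /= size_rcons size_mkseq.
    by rewrite mkseqSl mkseqS /= X0 Xn.
  move=> [n _]; rewrite /F; case: pickle_inv => [s|//]; case: ifPn => // xs.
  by move=> /AP [X0 _ Xs]; split => //; exists (size s).
have mE : measurable [set t | exists n, X n.+1 t = x].
  have -> : [set t | exists n, X n.+1 t = x] = \bigcup_n (X n.+1 @^-1` [set x]).
    by apply/seteqP; split => t /= [n]; [exists n | move=> _; exists n].
  by apply: bigcupT_measurable => n; exact: mX.
have P0 : P [set t | X 0%N t = x] = 1%E.
  rewrite -(Xlaw [::]); congr (P _); apply/seteqP.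
  by split => t; rewrite /mkseq /= ; [move=> -> | case].
have m0 : measurable [set t | X 0%N t = x] by exact: (mX 0%N x).
transitivity (P ([set t | X 0%N t = x] `&` [set t | exists n, X n.+1 t = x])).
  have N0 : P (~` [set t | X 0%N t = x]) = 0%E.
    by rewrite probability_setC // P0 subee.
  rewrite (measureDI P mE m0) setIC [X in (X + _)%E](_ : _ = 0%E) ?add0e //.
  apply/eqP; rewrite -measure_le0 -N0; apply: le_measure; rewrite ?inE.
  - exact: measurableD.
  - exact: measurableC.
  - by move=> t [].
rewrite FE measure_bigcup; [|by move=> i _; exact: mF|exact: tF].
rewrite nneseries_esum; [|by move=> n _; exact: measure_ge0].
pose a n := P (F n).
have pD : set_inj D (choice.pickle : seq V -> nat).
  by move=> s s' _ _ /(pcan_inj choice.pickleK).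
transitivity (\esum_(n in [set choice.pickle s | s in D]) a n)%E.
  rewrite [RHS]esum_mkcond set_mem_set; apply: eq_esum => n _.
  case: ifPn => //; rewrite notin_setE => Dn; rewrite /a /F.
  case un : (pickle_inv n) => [s|]; last by rewrite measure0.
  case: ifPn => xs; last by rewrite measure0.
  by case: Dn; exists s => //; have := @pickle_invK (seq V) n; rewrite un.
rewrite esum_image //; apply: eq_esum => s Ds.
rewrite /a /F pickleK_inv ifT // -Xlaw.
reflexivity.
Qed.

End RandomWalk.

Section Disorder.
Context (R : realType) d (T : measurableType d) (P : probability T R).

Definition mutually_independent (I : choiceType) (D : set I)
    (X : I -> {RV P >-> R}) :=
  forall J : {fset I}, [set` J] `<=` D ->
  forall B : I -> set R, (forall i, measurable (B i)) ->
  P (\bigcap_(i in [set` J]) (X i @^-1` B i)) =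
  (\prod_(i <- J) P (X i @^-1` B i))%E.

Definition iid_uniform01 (I : choiceType) (D : set I) (X : I -> {RV P >-> R}) :=
  mutually_independent D X /\
  forall i, D i -> forall B : set R, measurable B ->
    distribution P (X i) B = uniform_prob (@ltr01 R) B.

Definition disordered (V : choiceType) (U : set V -> {RV P >-> R})
    (c1 c2 : set V -> R) (p : R) (t : T) (e : set V) : R :=
  if U e t <= p then c1 e else c2 e.

End Disorder.

Definition line_adj : rel int := fun x y => `|x - y| == 1.

Definition cartesian_adj (V W : eqType) (g : rel V) (h : rel W) : rel (V * W) :=
  fun u v => (g u.1 v.1) && (u.2 == v.2) || (u.1 == v.1) && (h u.2 v.2).

(* The network on the line whose conductance at {x, x+1} is the maximum over
   [w : W] of the conductance of {(x, w), (x+1, w)}, which is the image of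
   {x, x+1} under [fun x => (x, w)]. *)
Definition max_projection (R : realType) (W : finType) (c : set (int * W) -> R)
    (e : set int) : R :=
  \big[Num.max/0]_(w : W) c [set (x, w) | x in e].

Section Cayley.
Context (G : groupType).
Local Open Scope group_scope.

Definition generates (S : seq G) :=
  forall H : {pred G}, group_closed H -> {subset S <= H} -> forall x, x \in H.

(* Neither closure of [S] under inverses nor [1 \notin S] is assumed: edges are
   undirected and loops are discarded. *)
Definition cayley_adj (S : seq G) : rel G :=
  fun x y => (x != y) && ((x^-1 * y \in S) || (y^-1 * x \in S)).

(* The subgroup isomorphic to the integers is the image of [phi]; it has finitely
   many left cosets. *)
Definition virtually_Z :=
  exists phi : {multiplicative Algebra.to_multiplicative int -> G},
    injective phi /\ finite_set [set [set x * phi n | n in setT] | x in setT].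

End Cayley.

(* Main.v *)
Require Import Defs.
From HB Require Import structures.
From mathcomp Require Import all_boot all_order all_algebra finmap.
From mathcomp Require Import all_classical all_reals all_analysis.
From mathcomp Require Import measurable_realfun.
From mathcomp Require Import zify ring lra.

Import Order.TTheory GRing.Theory Num.Theory.
Import numFieldNormedType.Exports.

Set Implicit Arguments.
Unset Strict Implicit.
Unset Printing Implicit Defensive.

Local Open Scope classical_set_scope.
Local Open Scope ring_scope.

(** Each part rests on three facts.

    A network is recurrent as soon as, for every vertex x, there are finitely
    supported functions phi with phi x = 1 and arbitrarily small Dirichlet energy
    (return_prob_small_energy).  If f is the probability of never hitting x, then
    f is harmonic off x, and testing harmonicity against phi ^+ 2 * f gives a
    Caccioppoli inequality: the energy of f, weighted by phi ^+ 2, is at most a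
    constant times the energy of phi.  Small energies therefore force f to be
    constant along the edges at x, that is, to vanish at the neighbours of x.

    Such functions come from disjoint cutsets, as in the Nash-Williams criterion.
    All the graphs at hand have a height pi with values in the integers, with
    bounded jumps along edges and level sets of bounded size, so that the edges crossing
    the levels 0, L, 2L, ... form disjoint cutsets of bounded size.  A function of
    pi that drops by rho k across the k-th cutset, where rho k is at most the
    inverse of the conductance of the cutset, has energy at most twice the sum of
    the rho k; after normalization the energy tends to 0 when the sum diverges
    (barrier_of_resistances).  The heights pi and - pi deal with the two ends, and
    the product of the two functions has finite support
    (recurrent_of_barriers).

    Finally, fix q < 1.  The k-th cutset has all its labels above q with a
    probability bounded below, independently over k, and then for all p <= q at
    once its conductance in the disordered network is the one given by c2, at most
    b k say.  The events being pairwise independent, Chebyshev's inequality shows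
    that the sum of the (1 + b k)^-1 over these closed cutsets diverges almost
    surely whenever the sum over all k does (ae_weighted_count_diverges).  A
    sequence of values q tending to 1 covers all p in [0, 1[.

    It remains to choose the height.  On the line and on its product with a finite
    graph it is the integer coordinate; the divergence of the sum of the
    (1 + b k)^-1 is then the recurrence of the network on the line, read off from
    an explicit superharmonic function (recurrent_ray_diverges).  Working with
    1 + b instead of b makes the criterion insensitive to vanishing
    conductances.  On a group with an infinite cyclic subgroup of finite index, the
    image of phi, the height is the exponent n of an element written phi n * r, with r
    in a finite set of representatives of right cosets, and b is constant.  The integers themselves are such a group. *)

(** * First-step analysis of the return probability *)

Lemma big_uniq_sub (R : nmodType) (I : eqType) (s t : seq I) (F : I -> R) :
  uniq s -> uniq t -> {subset s <= t} ->
  (forall i, i \in t -> i \notin s -> F i = 0) ->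
  \sum_(i <- t) F i = \sum_(i <- s) F i.
Proof.
move=> us ut st F0; rewrite (bigID (mem s)) /= [X in _ + X]big_seq_cond.
rewrite [X in _ + X]big1 ?addr0; last by move=> i /andP[]; exact: F0.
rewrite -big_filter; apply: perm_big; apply: uniq_perm => //.
  exact: filter_uniq.
by move=> i; rewrite mem_filter; case: (boolP (i \in s)) => //= /st ->.
Qed.

Lemma ler_sum_uniq_sub (R : numDomainType) (I : eqType) (s t : seq I) (F : I -> R) :
  uniq s -> {subset s <= t} -> (forall i, 0 <= F i) ->
  \sum_(i <- s) F i <= \sum_(i <- t) F i.
Proof.
move=> us st F0.
have -> : \sum_(i <- s) F i = \sum_(i <- undup t) if i \in s then F i else 0.
  rewrite [RHS](@big_uniq_sub _ _ s) ?undup_uniq //.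
  - by apply: eq_big_seq => i ->.
  - by move=> i /st; rewrite mem_undup.
  - by move=> i _ /negbTE ->.
apply: (@le_trans _ _ (\sum_(i <- undup t) F i)).
  by apply: ler_sum => i _; case: ifP.
elim: t {st} => //= a t IH; case: ifP => _; rewrite !big_cons ?lerD2l //.
by apply: (le_trans IH); rewrite lerDr.
Qed.

Lemma esumZ (R : realType) (I : choiceType) (D : set I) (a : R) (f : I -> \bar R) :
  0 <= a -> (forall i, (0 <= f i)%E) ->
  (\esum_(i in D) (a%:E * f i) = a%:E * \esum_(i in D) f i)%E.
Proof.
move=> a0 f0; rewrite /esum -ereal_supZl //; last first.
  apply/set0P; exists (\sum_(i \in set0) f i)%E; exists set0 => //; exact: fsets_set0.
congr ereal_sup; apply/seteqP; split=> [_ [X DX <-]|_ [_ [X DX <-] <-]].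
  exists (\sum_(i \in X) f i)%E; first by exists X.
  by rewrite ge0_mule_fsumr.
by exists X => //; rewrite ge0_mule_fsumr.
Qed.

Section Network.
Context (R : realType) (V : choiceType) (adj : rel V).
Context (adjC : symmetric adj) (adjx : irreflexive adj).
Context (lf : forall x, finite_set [set y | adj x y]).
Implicit Types (c : set V -> R) (x y z : V) (s : seq V).

(** Extending the conductance by 0 to all pairs of vertices gives a symmetric
    kernel, which can be summed over any finite set containing the neighbours. *)
Definition edge_weight c x y : R := if adj x y then c [set x; y] else 0.

Definition neighbors x : seq V := fset_set [set y | adj x y].

Lemma neighbors_uniq x : uniq (neighbors x).
Proof. exact: fset_uniq. Qed.

Lemma mem_neighbors x y : (y \in neighbors x) = adj x y.
Proof.
by rewrite /neighbors in_fset_set //; apply/idP/idP; rewrite inE.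
Qed.

Lemma edge_weightC c x y : edge_weight c x y = edge_weight c y x.
Proof. by rewrite /edge_weight adjC setUC. Qed.

Lemma edge_weight_ge0 c x y : conductance adj c -> 0 <= edge_weight c x y.
Proof. by move=> c0; rewrite /edge_weight; case: ifP => // xy; apply: c0; exists (x, y). Qed.

Lemma vertex_weightE c x : vertex_weight adj c x = \sum_(y <- neighbors x) edge_weight c x y.
Proof.
rewrite /vertex_weight.
have -> : [set e | edges adj e /\ e x] = [set [set x; y] | y in [set y | adj x y]].
  apply/seteqP; split=> e /=.
    move=> [[[a b]] /= ab <-] /= [->|->]; first by exists b.
    by exists a; rewrite 1?adjC // setUC.
  by move=> [y xy <-]; split; [exists (x, y)|left].
rewrite (reindex_fsbig (fun y => [set x; y]) [set y | adj x y]); last first.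
  split=> //.
  move=> y y' /set_mem /= xy _ /seteqP[E _].
  have yy : [set x; y] y by right.
  by have [yx|//] := E y yy; rewrite yx adjx in xy.
rewrite fsbig_finite //= /neighbors; apply: eq_big_seq => y.
by rewrite in_fset_set // inE /edge_weight => /= ->.
Qed.

Lemma sum_edge_weight c x (B : seq V) : uniq B -> (forall y, adj x y -> y \in B) ->
  forall F : V -> R, \sum_(y <- B) edge_weight c x y * F y =
  \sum_(y <- neighbors x) edge_weight c x y * F y.
Proof.
move=> uB nB F; apply: big_uniq_sub => //; first exact: neighbors_uniq.
  by move=> y; rewrite mem_neighbors; exact: nB.
by move=> y _; rewrite mem_neighbors /edge_weight => /negbTE ->; rewrite mul0r.
Qed.

Lemma vertex_weight_ge0 c x : conductance adj c -> 0 <= vertex_weight adj c x.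
Proof.
by move=> c0; rewrite vertex_weightE sumr_ge0 // => y _; exact: edge_weight_ge0.
Qed.

Lemma vertex_weight_gt0 c x y : conductance adj c -> 0 < edge_weight c x y ->
  0 < vertex_weight adj c x.
Proof.
move=> c0 k0; rewrite vertex_weightE; apply: (lt_le_trans k0).
rewrite -[leLHS](big_seq1 +%R y (edge_weight c x)) ler_sum_uniq_sub // => [z|z].
  by rewrite inE mem_neighbors => /eqP ->; move: k0; rewrite /edge_weight; case: ifP; rewrite ?ltxx.
exact: edge_weight_ge0.
Qed.

Lemma step_probE c x y : step_prob adj c x y = edge_weight c x y / vertex_weight adj c x.
Proof. by rewrite /step_prob /edge_weight; case: ifP => // _; rewrite mul0r. Qed.

Section Fixed.
Context (c : set V -> R) (c0 : conductance adj c).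

Lemma step_prob_ge0 x y : 0 <= step_prob adj c x y.
Proof. by rewrite step_probE divr_ge0 ?edge_weight_ge0 ?vertex_weight_ge0. Qed.

Lemma traj_prob_ge0 x s : 0 <= traj_prob adj c x s.
Proof. by elim: s x => //= y s IH x; rewrite mulr_ge0 ?step_prob_ge0. Qed.

(** The set D restricts the trajectories before the visit to x: it will be the set
    of all sequences avoiding x, or of those of bounded length, on which
    inductions run. *)
Definition hit x (D : set (seq V)) y : \bar R :=
  (\esum_(s in D) (traj_prob adj c y (rcons s x))%:E)%E.

Lemma hit_ge0 x D y : (0 <= hit x D y)%E.
Proof. by apply: esum_ge0 => s _; rewrite lee_fin traj_prob_ge0. Qed.

(** The Markov property at time 1, for an arbitrary set of trajectories: a
    nonempty sequence is cut after its first vertex. *)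
Lemma hit_first_step x D y :
  hit x D y = ((if [::] \in D then (step_prob adj c y x)%:E else 0) +
    \sum_(z <- neighbors y) (step_prob adj c y z)%:E * hit x [set s | D (z :: s)] z)%E.
Proof.
pose f s := (traj_prob adj c y (rcons s x))%:E.
have f0 s : (0 <= f s)%E by rewrite lee_fin traj_prob_ge0.
rewrite {1}/hit -/f (@esumID _ _ [set [::]] D f (fun s _ => f0 s)); congr (_ + _)%E.
  case: ifPn => [/set_mem D0|/negP D0].
    have -> : D `&` [set [::]] = [set [::]].
      by apply/seteqP; split=> [s []//|_ ->].
    by rewrite esum_set1 // /f /= mulr1.
  have -> : D `&` [set [::]] = set0.
    by apply/seteqP; split=> s //= [Ds sE]; apply: D0; rewrite inE -sE.
  exact: esum_set0.
pose J z := [set s | D (z :: s)].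
transitivity (\esum_(k in [set: V] `*`` J) f (k.1 :: k.2))%E.
  apply: reindex_esum; split.
  - by move=> [z s] [_ /= Ds]; split.
  - by move=> [z s] [z' s'] _ _ /= [-> ->].
  - by move=> [|z s] [Ds ns]; [case: ns|exists (z, s)].
rewrite -(@esum_esum _ _ _ _ J (fun z s => f (z :: s))) //.
transitivity (\esum_(z in [set: V]) (if z \in [set z | adj y z] then
  (step_prob adj c y z)%:E * hit x (J z) z else 0))%E.
  apply: eq_esum => z _; case: ifPn => [_|].
    under eq_esum => s _ do rewrite /f /= EFinM.
    by rewrite esumZ ?step_prob_ge0 // => s; rewrite lee_fin traj_prob_ge0.
  move=> yz; apply: esum1 => s _; rewrite /f /= /step_prob ifF ?mul0r //.
  by apply/negbTE/negP => h; move/negP: yz; apply; rewrite inE.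
rewrite -esum_mkcond esum_fset //; last first.
  by move=> z _; rewrite mule_ge0 ?lee_fin ?step_prob_ge0 ?hit_ge0.
by rewrite fsbig_finite.
Qed.

Definition avoiding x : set (seq V) := [set s : seq V | x \notin s].

Lemma hit_avoiding x (D : set (seq V)) y : D [::] -> D `<=` avoiding x ->
  hit x D y = (\sum_(z <- neighbors y) (step_prob adj c y z)%:E *
    (if z == x then 1 else hit x [set s | D (z :: s)] z))%E.
Proof.
move=> D0 DA; rewrite hit_first_step mem_set //.
have -> : ((step_prob adj c y x)%:E = \sum_(z <- neighbors y)
    if z == x then (step_prob adj c y z)%:E else 0)%E.
  case: (boolP (adj y x)) => yx.
    rewrite (bigD1_seq x) ?neighbors_uniq ?mem_neighbors //= eqxx.
    by rewrite big1 ?adde0 // => z /negbTE ->.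
  rewrite {1}/step_prob (negbTE yx) big_seq big1 // => z.
  by rewrite mem_neighbors => yz; case: eqP => // zx; rewrite -zx yz in yx.
rewrite -big_split; apply: eq_bigr => z _ /=; case: eqP => [->|_]; last by rewrite add0e.
rewrite [X in (_ * X)%E](_ : _ = 0%E) ?mule0 ?adde0 ?mule1 //.
apply: esum1 => s /DA.
by rewrite /avoiding /= inE eqxx.
Qed.

Lemma hit_avoiding_first_step x y :
  hit x (avoiding x) y = (\sum_(z <- neighbors y) (step_prob adj c y z)%:E *
    (if z == x then 1 else hit x (avoiding x) z))%E.
Proof.
rewrite hit_avoiding //; apply: eq_bigr => z _; case: eqP => // /eqP zx.
congr (_ * hit _ _ _)%E; apply/seteqP; split=> s; rewrite /avoiding /= inE negb_or eq_sym zx //.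
Qed.

(** The hitting probability of x is the least nonnegative superharmonic function
    off x with value 1 at x: by induction on n, h dominates the probability of
    hitting x along a trajectory with fewer than n intermediate vertices, and
    every finite set of trajectories has bounded length. *)
Lemma hit_le_superharmonic x (h : V -> R) : (forall y, 0 <= h y) -> h x = 1 ->
  (forall y, y != x -> \sum_(z <- neighbors y) step_prob adj c y z * h z <= h y) ->
  forall y, y != x -> (hit x (avoiding x) y <= (h y)%:E)%E.
Proof.
move=> h0 hx hs.
pose D n := [set s : seq V | x \notin s /\ (size s < n)%N].
have hD n y : y != x -> (hit x (D n) y <= (h y)%:E)%E.
  elim: n y => [|n IH] y yx.
    by rewrite /hit esum1 ?lee_fin // => s [].
  rewrite hit_avoiding; [|by []|by move=> s []].
  apply: le_trans (_ : _ <= (\sum_(z <- neighbors y) step_prob adj c y z * h z)%:E)%E _; last first.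
    by rewrite lee_fin hs.
  rewrite -sumEFin; apply: lee_sum => z _; rewrite EFinM.
  apply: lee_wpmul2l; first by rewrite lee_fin step_prob_ge0.
  case: eqP => [->|/eqP zx]; first by rewrite hx.
  apply: (le_trans _ (IH z zx)).
  rewrite (_ : [set s | D n.+1 (z :: s)] = D n) //.
  by apply/seteqP; split=> s; rewrite /D /= inE negb_or eq_sym zx ltnS.
move=> y yx; apply: ge_ereal_sup => _ [X [finX XA] <-].
have [n Xn] : exists n, X `<=` D n.
  exists (\max_(s <- fset_set X) size s).+1 => s Xs; split; first exact: XA.
  have sX : s \in enum_fset (fset_set X) by have := in_fset_set finX s; rewrite mem_set.
  by rewrite ltnS; exact: (leq_bigmax_seq (F := size) s sX).
apply: le_trans (hD n y yx); apply: esum_ge; exists X => //; split => //.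
Qed.

Lemma sum_step_prob y : 0 < vertex_weight adj c y ->
  \sum_(z <- neighbors y) step_prob adj c y z = 1.
Proof.
move=> w0; under eq_bigr do rewrite step_probE.
by rewrite -mulr_suml -vertex_weightE divff // gt_eqF.
Qed.

Lemma sum_step_prob_le1 y : \sum_(z <- neighbors y) step_prob adj c y z <= 1.
Proof.
have := vertex_weight_ge0 y c0; rewrite le_eqVlt => /orP[/eqP w0|/sum_step_prob->//].
by rewrite big1 // => z _; rewrite step_probE -w0 invr0 mulr0.
Qed.

Lemma hit_le1 x y : y != x -> (hit x (avoiding x) y <= 1)%E.
Proof.
move=> yx; apply: (@hit_le_superharmonic x (fun=> 1)) => // z _.
by under eq_bigr do rewrite mulr1; exact: sum_step_prob_le1.
Qed.

(** The value 1 at x makes this function harmonic off x without boundary terms;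
    the probability of returning to x is its mean over the neighbours of x. *)
Definition hitting x y : R := if y == x then 1 else fine (hit x (avoiding x) y).

Lemma hitE x y : hit x (avoiding x) y =
  (\sum_(z <- neighbors y) step_prob adj c y z * hitting x z)%:E.
Proof.
rewrite hit_avoiding_first_step -sumEFin; apply: eq_bigr => z _.
rewrite EFinM /hitting; case: eqP => // /eqP zx; rewrite fineK //.
rewrite ge0_fin_numE ?hit_ge0 //; apply: le_lt_trans (hit_le1 zx) _.
exact: ltry.
Qed.

Lemma hitting_ge0 x y : 0 <= hitting x y.
Proof. by rewrite /hitting; case: eqP => // _; rewrite fine_ge0 ?hit_ge0. Qed.

Lemma hitting_le1 x y : hitting x y <= 1.
Proof.
rewrite /hitting; case: eqP => // /eqP /hit_le1.
by rewrite hitE lee_fin.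
Qed.

(** Written with edge weights rather than transition probabilities, harmonicity
    also holds at the vertices of weight zero, where all the terms vanish. *)
Lemma hitting_harmonic x y : y != x ->
  \sum_(z <- neighbors y) edge_weight c y z * (hitting x z - hitting x y) = 0.
Proof.
move=> yx; have := vertex_weight_ge0 y c0; rewrite le_eqVlt => /orP[/eqP w0|w0].
  rewrite big_seq big1 // => z yz; suff -> : edge_weight c y z = 0 by rewrite mul0r.
  apply/eqP; rewrite eq_le edge_weight_ge0 // andbT leNgt; apply/negP => /vertex_weight_gt0.
  by rewrite -w0 ltxx => /(_ c0).
under eq_bigr do rewrite mulrBr.
rewrite sumrB -mulr_suml -vertex_weightE; apply/eqP; rewrite subr_eq0; apply/eqP.
have -> : hitting x y = \sum_(z <- neighbors y) step_prob adj c y z * hitting x z.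
  by rewrite {1}/hitting (negbTE yx) hitE.
rewrite mulr_sumr; apply: eq_bigr => z _.
by rewrite step_probE mulrA [_ * (_ / _)]mulrCA divff ?mulr1 // gt_eqF.
Qed.

(** Every edge inside B is counted twice, once for each orientation. *)
Definition energy (B : seq V) (phi : V -> R) : R :=
  \sum_(a <- B) \sum_(b <- B) edge_weight c a b * (phi a - phi b) ^+ 2.

(** With D = fb - fa and s the mean of fa and fb, the product of the increments of
    f and phi ^+ 2 * f is D ^+ 2 times the mean of u ^+ 2 and v ^+ 2, plus the
    cross term s * D * (v ^+ 2 - u ^+ 2), which is absorbed by Young's inequality
    since s <= 1. *)
Lemma caccioppoli_pointwise (fa fb u v : R) : 0 <= fa <= 1 -> 0 <= fb <= 1 ->
  (fb - fa) ^+ 2 * (u ^+ 2 + v ^+ 2) <=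
  4 * (fb - fa) * (v ^+ 2 * fb - u ^+ 2 * fa) + 8 * (u - v) ^+ 2.
Proof.
move=> /andP[fa0 fa1] /andP[fb0 fb1].
set D := fb - fa; set s := (fa + fb) / 2.
have s01 : 0 <= s <= 1 by rewrite /s; lra.
have -> : v ^+ 2 * fb - u ^+ 2 * fa =
    D * (u ^+ 2 + v ^+ 2) / 2 + s * (v ^+ 2 - u ^+ 2).
  by rewrite /s /D; field.
have s2 : s ^+ 2 <= 1 by case/andP: s01 => s0 s1; rewrite expr_le1.
have e1 : 0 <= (D * (u + v) / 2 + 2 * s * (v - u)) ^+ 2 by exact: sqr_ge0.
have e2 : 0 <= D ^+ 2 * (u - v) ^+ 2 by rewrite mulr_ge0 ?sqr_ge0.
have e3 : 0 <= (1 - s ^+ 2) * (u - v) ^+ 2 by rewrite mulr_ge0 ?sqr_ge0 // subr_ge0.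
move: e1 e2 e3; clearbody D s; lra.
Qed.

(** The inequality of Caccioppoli: phi ^+ 2 * f vanishes at x and has finite
    support, so by harmonicity of f off x and Green's formula its energy pairing
    with f is zero; then the pointwise inequality is summed over the edges. *)
Lemma caccioppoli x (f phi : V -> R) (S B : seq V) :
  f x = 0 -> (forall y, 0 <= f y <= 1) ->
  (forall y, y != x -> \sum_(z <- neighbors y) edge_weight c y z * (f z - f y) = 0) ->
  (forall y, y \notin S -> phi y = 0) ->
  uniq B -> (forall y z, y \in S -> adj y z -> z \in B) ->
  \sum_(a <- B) \sum_(b <- B)
    edge_weight c a b * ((f b - f a) ^+ 2 * (phi a ^+ 2 + phi b ^+ 2)) <= 8 * energy B phi.
Proof.
move=> fx f01 harm supp uB SB.
pose g y := phi y ^+ 2 * f y.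
have half : \sum_(a <- B) \sum_(b <- B) edge_weight c a b * ((f b - f a) * g a) = 0.
  apply: big1 => a _; have [->|ax] := eqVneq a x.
    by apply: big1 => b _; rewrite /g fx; ring.
  case: (boolP (a \in S)) => aS; last first.
    by apply: big1 => b _; rewrite /g supp // expr0n /=; ring.
  under eq_bigr do rewrite mulrA.
  by rewrite -mulr_suml sum_edge_weight ?harm ?mul0r // => y; exact: SB.
have half' : \sum_(a <- B) \sum_(b <- B) edge_weight c a b * ((f b - f a) * g b) = 0.
  rewrite exchange_big; apply: oppr_inj; rewrite oppr0 -[RHS]half -sumrN.
  apply: eq_bigr => b _; rewrite -sumrN; apply: eq_bigr => a _.
  by rewrite edge_weightC; ring.
have green : \sum_(a <- B) \sum_(b <- B) edge_weight c a b * ((f b - f a) * (g b - g a)) = 0.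
  transitivity (\sum_(a <- B) \sum_(b <- B) edge_weight c a b * ((f b - f a) * g b) -
    \sum_(a <- B) \sum_(b <- B) edge_weight c a b * ((f b - f a) * g a)).
    rewrite -sumrB; apply: eq_bigr => a _.
    by rewrite -sumrB; apply: eq_bigr => b _; ring.
  by rewrite half half' subrr.
have -> : 8 * energy B phi = 4 * (\sum_(a <- B) \sum_(b <- B)
    edge_weight c a b * ((f b - f a) * (g b - g a))) + 8 * energy B phi.
  by rewrite green mulr0 add0r.
rewrite /energy !mulr_sumr -big_split.
apply: ler_sum => a _; rewrite !mulr_sumr -big_split; apply: ler_sum => b _ /=.
have := ler_wpM2l (edge_weight_ge0 a b c0) (caccioppoli_pointwise (phi a) (phi b) (f01 a) (f01 b)).
by rewrite /g => h; apply: (le_trans h); rewrite le_eqVlt; apply/orP; left; apply/eqP; ring.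
Qed.

(** Recurrence is the vanishing of the capacity of x.  For f the probability of
    never hitting x, each edge from x to z contributes its weight times f z ^+ 2 to
    the weighted energy of f, which is at most 8 times the energy of phi and hence
    arbitrarily small. *)
Lemma return_prob_small_energy x :
  (forall eps, 0 < eps -> exists (phi : V -> R) (S : seq V),
    [/\ phi x = 1, forall y, y \notin S -> phi y = 0
      & forall B, uniq B -> energy B phi <= eps]) ->
  0 < vertex_weight adj c x -> return_prob adj c x = 1%E.
Proof.
move=> small w0; pose f y := 1 - hitting x y.
have f0 z : edge_weight c x z * f z ^+ 2 = 0.
  apply/eqP; rewrite eq_le mulr_ge0 ?edge_weight_ge0 ?sqr_ge0 // andbT.
  apply/ler_addgt0Pr => eps eps0; rewrite add0r.
  have [phi [S [phix supp En]]] := small (eps / 8) (divr_gt0 eps0 (ltr0n _ 8)).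
  case: (boolP (adj x z)) => xz; last by rewrite /edge_weight (negbTE xz) mul0r ltW.
  (* The support of phi with its neighbours, on which Green's formula holds. *)
  pose B := undup (x :: z :: flatten (map neighbors S)).
  have fx : f x = 0 by rewrite /f /hitting eqxx subrr.
  have xB : x \in B by rewrite mem_undup inE eqxx.
  have zB : z \in B by rewrite mem_undup !inE eqxx orbT.
  have cac : \sum_(a <- B) \sum_(b <- B)
      edge_weight c a b * ((f b - f a) ^+ 2 * (phi a ^+ 2 + phi b ^+ 2)) <= eps.
    apply: le_trans (_ : 8 * energy B phi <= _); last first.
      by rewrite mulrC -ler_pdivlMr // En ?undup_uniq.
    apply: (caccioppoli fx _ _ supp) => [y|y yx||a b aS ab].
    - by rewrite /f subr_ge0 hitting_le1 lerBlDr lerDl hitting_ge0.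
    - apply: oppr_inj; rewrite oppr0 -[RHS](hitting_harmonic yx) -sumrN; apply: eq_bigr => a _.
      by rewrite /f; ring.
    - exact: undup_uniq.
    - rewrite mem_undup !inE; apply/orP; right; apply/orP; right.
      by apply/flatten_mapP; exists a => //; rewrite mem_neighbors.
  apply: le_trans cac; rewrite (bigD1_seq x) ?undup_uniq //= (bigD1_seq z) ?undup_uniq //=.
  have term0 a b : 0 <= edge_weight c a b * ((f b - f a) ^+ 2 * (phi a ^+ 2 + phi b ^+ 2)).
    apply: mulr_ge0; [exact: edge_weight_ge0|apply: mulr_ge0; first exact: sqr_ge0].
    by apply: addr_ge0; exact: sqr_ge0.
  rewrite -addrA; apply: ler_wpDr.
    apply: addr_ge0; apply: sumr_ge0 => a _; first exact: term0.
    by apply: sumr_ge0 => b _; exact: term0.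
  rewrite fx subr0 phix expr1n ler_wpM2l ?edge_weight_ge0 // ler_peMr ?sqr_ge0 //.
  by rewrite lerDl sqr_ge0.
rewrite /return_prob -/(hit x (avoiding x) x) hitE -(sum_step_prob w0); congr EFin.
apply: eq_bigr => z _; have -> : hitting x z = 1 - f z by rewrite /f subKr.
move/eqP: (f0 z); rewrite mulf_eq0 sqrf_eq0 => /orP[] /eqP h.
  by rewrite step_probE h !mul0r.
by rewrite h subr0 mulr1.
Qed.

Lemma sum_step_prob_edge_weight (h : V -> R) y : 0 < vertex_weight adj c y ->
  \sum_(z <- neighbors y) step_prob adj c y z * h z =
  h y + (\sum_(z <- neighbors y) edge_weight c y z * (h z - h y)) / vertex_weight adj c y.
Proof.
move=> w0; apply/eqP; rewrite -subr_eq0 opprD addrA subr_eq0.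
rewrite -[X in _ - X]mul1r -(sum_step_prob w0) [X in _ - X]mulr_suml -sumrB mulr_suml.
by apply/eqP; apply: eq_bigr => z _; rewrite step_probE; ring.
Qed.

(** A witness of transience: a nonnegative superharmonic function off x that has a
    strictly smaller mean around x than at x bounds the hitting probabilities from
    the neighbours of x. *)
Lemma return_prob_lt1 x (h : V -> R) : (forall y, 0 <= h y) -> h x = 1 ->
  (forall y, y != x -> \sum_(z <- neighbors y) edge_weight c y z * (h z - h y) <= 0) ->
  \sum_(z <- neighbors x) edge_weight c x z * (h z - h x) < 0 ->
  0 < vertex_weight adj c x -> (return_prob adj c x < 1)%E.
Proof.
move=> h0 hx sup supx w0.
rewrite /return_prob -/(hit x (avoiding x) x) hit_avoiding_first_step.
apply: (@le_lt_trans _ _ (\sum_(z <- neighbors x) step_prob adj c x z * h z)%:E).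
  rewrite -sumEFin; apply: lee_sum => z _; rewrite EFinM.
  apply: lee_wpmul2l; first by rewrite lee_fin step_prob_ge0.
  case: eqP => [->|/eqP zx]; first by rewrite hx.
  apply: hit_le_superharmonic => // y yx.
  have := vertex_weight_ge0 y c0; rewrite le_eqVlt => /orP[/eqP wy0|wy0].
    by rewrite big1 // => u _; rewrite step_probE -wy0 invr0 mulr0 mul0r.
  by rewrite sum_step_prob_edge_weight // gerDl mulr_le0_ge0 ?sup // invr_ge0 ltW.
by rewrite lte_fin sum_step_prob_edge_weight // hx gtrDl pmulr_llt0 ?invr_gt0 // -hx.
Qed.

End Fixed.
End Network.

(** * Networks on the line *)

(** For nonnegative r, the divergence of the series. *)
Definition diverges (R : realType) (r : nat -> R) :=
  forall M, exists n, M <= \sum_(0 <= k < n) r k.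

Lemma tail_lt_of_not_diverges (R : realType) (r : nat -> R) : (forall n, 0 <= r n) ->
  ~ diverges r -> forall eps, 0 < eps -> exists N, forall n, \sum_(N <= k < n) r k < eps.
Proof.
move=> r0 /existsNP[M /forallNP HM] eps eps0.
pose S := range (fun n => \sum_(0 <= k < n) r k).
have hS : has_sup S.
  split; first by exists (\sum_(0 <= k < 0) r k), 0%N.
  by exists M => _ [n _ <-]; rewrite leNgt; apply/negP => /ltW /HM.
have [_ [N _ <-] SN] := sup_adherent eps0 hS.
exists N => n; have [nN|Nn] := leqP n N; first by rewrite big_geq.
have : \sum_(0 <= k < n) r k <= sup S by apply: ub_le_sup; [case: hS|exists n].
by rewrite (@big_cat_nat _ _ _ N) //= 1?ltnW //; lra.
Qed.

Section Line.
Context (R : realType) (c : set int -> R) (c0 : conductance line_adj c).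

Lemma line_adjC : symmetric line_adj.
Proof. by move=> x y; rewrite /line_adj distrC. Qed.

Lemma line_adjx : irreflexive line_adj.
Proof. by move=> x; rewrite /line_adj subrr. Qed.

Lemma line_adjE (x y : int) : line_adj x y = (y == x + 1) || (y == x - 1).
Proof. by rewrite /line_adj; lia. Qed.

Lemma line_finite x : finite_set [set y | line_adj x y].
Proof.
apply: (@sub_finite_set _ _ [set x + 1; x - 1]); last exact: finite_set2.
by move=> y /=; rewrite line_adjE => /orP[] /eqP ->; [left|right].
Qed.

(* The sign sg selects one of the two ends of the line. *)
Context (sg : int) (sg1 : sg * sg = 1).

Lemma sg_cases : sg = 1 \/ sg = -1.
Proof. by move: sg1; nia. Qed.

Definition ray_conductance (n : nat) : R := c [set sg * n%:Z; sg * (n%:Z + 1)].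

Lemma ray_adj m : line_adj (sg * m) (sg * (m + 1)).
Proof. by rewrite line_adjE; case: sg_cases => ->; lia. Qed.

Lemma ray_conductance_ge0 n : 0 <= ray_conductance n.
Proof. by apply: c0; exists (sg * n%:Z, sg * (n%:Z + 1)) => //=; exact: ray_adj. Qed.

(** The two terms are the steps that increase and decrease the height sg * x. *)
Lemma sum_line_neighbors (F : int -> R) m :
  \sum_(z <- neighbors line_adj (sg * m)) edge_weight line_adj c (sg * m) z * F z =
  edge_weight line_adj c (sg * m) (sg * (m + 1)) * F (sg * (m + 1)) +
  edge_weight line_adj c (sg * (m - 1)) (sg * m) * F (sg * (m - 1)).
Proof.
rewrite -(@sum_edge_weight _ _ _ line_finite _ _ [:: sg * (m + 1); sg * (m - 1)]).
- by rewrite big_cons big_seq1 [X in _ + X * _]edge_weightC //; exact: line_adjC.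
- by rewrite /= inE andbT; case: sg_cases => ->; lia.
- by move=> y; rewrite line_adjE !inE; case: sg_cases => ->; lia.
Qed.

Lemma edge_weight_ray (n : nat) : edge_weight line_adj c (sg * n%:Z) (sg * (n%:Z + 1)) = ray_conductance n.
Proof. by rewrite /edge_weight ray_adj. Qed.

(** The potential theory of a ray with finite total resistance: the function that
    is 1 up to the vertex N and decreases across the edge k by a multiple of the
    resistance of k has the constant flux M^-1 beyond N.  It is thus harmonic
    there, and its drop at N makes the walk from N escape with positive
    probability. *)
Lemma line_transient (N : nat) (M : R) : 0 < M ->
  (forall n, (N <= n)%N -> 0 < ray_conductance n) ->
  (forall n, \sum_(N <= k < n) (ray_conductance k)^-1 <= M) ->
  ~ recurrent line_adj c.
Proof.
move=> M0 pos bnd rec.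
pose eta (m : int) : R :=
  if m is Posz k then 1 - (\sum_(N <= i < k) (ray_conductance i)^-1) / M else 1.
pose h (y : int) := eta (sg * y).
have hE m : h (sg * m) = eta m by rewrite /h mulrA sg1 mul1r.
have eta_le m : m <= N%:Z -> eta m = 1.
  by case: m => // k kN; rewrite /eta big_geq ?mul0r ?subr0 //; lia.
have etaS (k : nat) : (N <= k)%N ->
    eta (k%:Z + 1) - eta k%:Z = - ((ray_conductance k)^-1 / M).
  by move=> Nk; rewrite (_ : k%:Z + 1 = k.+1%:Z) /eta ?big_nat_recr //=; [ring|lia].
have flux (k : nat) : (N <= k)%N ->
    edge_weight line_adj c (sg * k%:Z) (sg * (k%:Z + 1)) *
    (eta (k%:Z + 1) - eta k%:Z) = - M^-1.
  by move=> Nk; rewrite edge_weight_ray etaS // mulrN mulrA divff ?mul1r // gt_eqF // pos.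
have w0 : 0 < vertex_weight line_adj c (sg * N%:Z).
  apply: (vertex_weight_gt0 (y := sg * (N%:Z + 1)) line_adjC line_adjx line_finite c0).
  by rewrite edge_weight_ray pos.
have := rec _ w0; apply/eqP; rewrite lt_eqF //.
apply: (@return_prob_lt1 _ _ _ line_adjC line_adjx line_finite _ c0 _ h) => //.
- move=> y; rewrite /h /eta; case: (sg * y) => // k.
  by rewrite subr_ge0 ler_pdivrMr // mul1r.
- by rewrite hE eta_le.
- move=> y yN; have [m ym] : exists m, y = sg * m.
    by exists (sg * y); rewrite mulrA sg1 mul1r.
  rewrite ym (sum_line_neighbors (fun z => h z - h (sg * m))) !hE.
  have [mN|mN|mN] := ltrgtP m N%:Z; last by rewrite ym mN eqxx in yN.
    by rewrite !eta_le ?subrr ?mulr0 ?addr0 //; lia.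
  have [k [mk Nk]] : exists k : nat, m = k%:Z + 1 /\ (N <= k)%N.
    by exists `|m - 1|%N; lia.
  rewrite mk addrK -[eta k%:Z - _]opprB mulrN (flux k Nk).
  have := flux k.+1 (leqW Nk); rewrite (_ : k.+1%:Z = k%:Z + 1) => [->|]; last by lia.
  by rewrite subrr.
- rewrite (sum_line_neighbors (fun z => h z - h (sg * N%:Z))) !hE flux //.
  by rewrite (eta_le (N%:Z - 1)) ?(eta_le N%:Z) ?subrr ?mulr0 ?addr0 ?oppr_lt0 ?invr_gt0 //; lia.
Qed.

(** If the series converged then the conductances would eventually exceed 1, hence
    be positive, and their inverses would be at most 2 * (1 + c)^-1, so that a tail
    of the ray would have finite total resistance.  With 1 + c in place of c,
    finitely many vanishing conductances cannot make the series diverge. *)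
Lemma recurrent_ray_diverges : recurrent line_adj c ->
  diverges (fun n => (1 + ray_conductance n)^-1).
Proof.
move=> rec; apply: contrapT => ndiv.
have c1 n : 0 < 1 + ray_conductance n by rewrite ltr_wpDr ?ray_conductance_ge0.
have r0 n : 0 <= (1 + ray_conductance n)^-1 by rewrite invr_ge0 ltW.
have [|N tail] := tail_lt_of_not_diverges r0 ndiv (eps := 2^-1); first by [].
have big n : (N <= n)%N -> 1 < ray_conductance n.
  move=> Nn; have : (1 + ray_conductance n)^-1 < 2^-1.
    apply: le_lt_trans (tail n.+1); rewrite big_nat_recr //= lerDr.
    by apply: sumr_ge0.
  by rewrite ltf_pV2 ?posrE //; lra.
apply: (@line_transient N 1) => //.
  by move=> n /big; apply: lt_trans.
move=> n; apply: (@le_trans _ _ (\sum_(N <= k < n) 2 * (1 + ray_conductance k)^-1)).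
  rewrite !big_nat; apply: ler_sum => k /andP[/big ck _].
  have ck0 : 0 < ray_conductance k by apply: lt_trans ck.
  by rewrite -[2]invrK -invfM lef_pV2 ?posrE ?mulr_gt0 ?invr_gt0 //; lra.
by rewrite -mulr_sumr; have := tail n; lra.
Qed.

End Line.

(** * Weighted sums of independent events *)

Section Events.
Context (R : realType) d (T : measurableType d) (P : probability T R).

(** Packing integrability with the value of the integral lets the moments of a
    finite combination of indicators be computed term by term. *)
Definition has_mean (f : T -> R) (e : R) :=
  P.-integrable setT (EFin \o f) /\ (\int[P]_t (f t)%:E = e%:E)%E.

Lemma has_mean_indic (A : set T) : measurable A -> has_mean \1_A (fine (P A)).
Proof.
move=> mA; split; first exact: integrable_indic.
by rewrite integral_indic // setIT fineK // fin_num_measure.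
Qed.

Lemma has_meanZ (a : R) f e : has_mean f e -> has_mean (fun t => a * f t) (a * e).
Proof.
move=> [fi fe]; split.
  rewrite (_ : EFin \o _ = fun t => (a%:E * (EFin \o f) t)%E); first exact: integrableZl.
  by apply/funext => t /=; rewrite EFinM.
under eq_integral do rewrite EFinM.
by rewrite (@integralZl _ _ _ _ _ _ (EFin \o f)) // fe.
Qed.

Lemma has_meanD f g e e' : has_mean f e -> has_mean g e' ->
  has_mean (fun t => f t + g t) (e + e').
Proof.
move=> [fi fe] [gi ge]; split.
  rewrite (_ : EFin \o _ = (EFin \o f) \+ (EFin \o g))%E; first exact: integrableD.
  by apply/funext => t /=; rewrite EFinD.
under eq_integral do rewrite EFinD.
by rewrite (@integralD _ _ _ _ _ _ (EFin \o f) (EFin \o g)) // fe ge.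
Qed.

Lemma has_mean_cst (a : R) : has_mean (fun=> a) a.
Proof.
have := has_meanZ a (has_mean_indic measurableT).
rewrite probability_setT /= mulr1; congr has_mean.
by apply/funext => t; rewrite indicE mem_set // mulr1.
Qed.

Lemma has_mean_sum (I : Type) (s : seq I) (F : I -> T -> R) (e : I -> R) :
  (forall i, has_mean (F i) (e i)) ->
  has_mean (fun t => \sum_(i <- s) F i t) (\sum_(i <- s) e i).
Proof.
move=> Fe; elim: s => [|i s IH].
  rewrite big_nil (_ : (fun t => _) = fun=> 0); first exact: has_mean_cst.
  by apply/funext => t; rewrite big_nil.
rewrite big_cons (_ : (fun t => _) = fun t => F i t + \sum_(j <- s) F j t).
  exact: has_meanD.
by apply/funext => t; rewrite big_cons.
Qed.

Lemma le_has_mean f g e e' : has_mean f e -> has_mean g e' ->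
  (forall t, f t <= g t) -> e <= e'.
Proof.
move=> [fi fe] [gi ge] fg; rewrite -lee_fin -fe -ge.
by apply: le_integral => // t _; rewrite lee_fin.
Qed.

Lemma measurable_weighted_count (A : nat -> set T) (r : nat -> R) n :
  (forall k, measurable (A k)) ->
  measurable_fun setT (fun t => \sum_(0 <= k < n) r k * \1_(A k) t).
Proof.
move=> mA; apply: measurable_sum => k.
by apply: measurable_funM => //; exact: measurable_indic.
Qed.

(** Chebyshev's inequality.  Pairwise independence leaves only the diagonal terms
    r k ^+ 2 * (p k - p k ^+ 2) in the variance, which is therefore at most the mean
    m since r k <= 1. *)
Lemma weighted_count_lower_tail (A : nat -> set T) (r : nat -> R) (n : nat) :
  (forall k, measurable (A k)) -> (forall k, 0 <= r k <= 1) ->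
  (forall k l, k != l -> P (A k `&` A l) = (P (A k) * P (A l))%E) ->
  let m := \sum_(0 <= k < n) r k * fine (P (A k)) in 0 < m ->
  fine (P [set t | \sum_(0 <= k < n) r k * \1_(A k) t <= m / 2]) <= 4 / m.
Proof.
move=> mA r01 ind m m0.
pose p k := fine (P (A k)).
have p01 k : 0 <= p k <= 1.
  rewrite /p fine_ge0 ?measure_ge0 //= -lee_fin fineK ?fin_num_measure //.
  exact: probability_le1.
pose X t := \sum_(0 <= k < n) r k * \1_(A k) t.
pose e := \sum_(0 <= k < n) \sum_(0 <= l < n) r k * r l * (fine (P (A k `&` A l)) - p k * p l).
have meanX : has_mean X m.
  by apply: has_mean_sum => k; apply: has_meanZ; exact: has_mean_indic.
have var : has_mean (fun t => (X t - m) ^+ 2) e.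
  have -> : (fun t => (X t - m) ^+ 2) = fun t =>
      \sum_(0 <= k < n) \sum_(0 <= l < n) r k * r l * \1_(A k `&` A l) t +
      ((- 2 * m) * X t + m ^+ 2).
    apply/funext => t; rewrite sqrrB.
    have -> : X t ^+ 2 = \sum_(0 <= k < n) \sum_(0 <= l < n) r k * r l * \1_(A k `&` A l) t.
      rewrite expr2 /X mulr_suml; apply: eq_bigr => k _.
      by rewrite mulr_sumr; apply: eq_bigr => l _; rewrite indicI /=; ring.
    by ring.
  have -> : e = \sum_(0 <= k < n) \sum_(0 <= l < n) r k * r l * fine (P (A k `&` A l)) +
      ((- 2 * m) * m + m ^+ 2).
    have -> : - 2 * m * m + m ^+ 2 =
        - \sum_(0 <= k < n) \sum_(0 <= l < n) r k * r l * (p k * p l).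
      rewrite (_ : - 2 * m * m + m ^+ 2 = - (m * m)); last by ring.
      congr (- _); rewrite {1}/m mulr_suml; apply: eq_bigr => k _.
      by rewrite /m mulr_sumr; apply: eq_bigr => l _; rewrite /p; ring.
    rewrite -sumrB; apply: eq_bigr => k _.
    by rewrite -sumrB; apply: eq_bigr => l _; ring.
  apply: has_meanD; last by apply: has_meanD; [exact: has_meanZ|exact: has_mean_cst].
  apply: has_mean_sum => k; apply: has_mean_sum => l; apply: has_meanZ.
  by apply: has_mean_indic; exact: measurableI.
have em : e <= m.
  rewrite /e /m !big_seq; apply: ler_sum => k; rewrite mem_index_iota => kn.
  rewrite (bigD1_seq k) ?iota_uniq ?mem_index_iota //= big1 => [|l lk]; last first.
    by rewrite ind 1?eq_sym // fineM ?fin_num_measure // subrr mulr0.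
  rewrite addr0 setIid -/(p k).
  have := p01 k; have := r01 k; move: (p k) (r k) => u v /andP[v0 v1] /andP[u0 u1].
  rewrite (_ : v * v * (u - u * u) = v * u * (v * (1 - u))); last by ring.
  by rewrite ler_piMr ?mulr_ge0 // mulr_ile1 ?subr_ge0 // gerBl.
pose F := [set t | X t <= m / 2].
have mF : measurable F.
  have := measurable_weighted_count r n mA => /(_ measurableT `]-oo, m / 2]%classic).
  rewrite setTI; move=> /(_ _); apply => //.
apply: (@le_trans _ _ (4 / m ^+ 2 * e)); last first.
  rewrite (_ : 4 / m = 4 / m ^+ 2 * m); last by field; rewrite gt_eqF.
  by apply: ler_wpM2l => //; rewrite divr_ge0 ?sqr_ge0.
apply: (le_has_mean (has_mean_indic mF) (has_meanZ _ var)) => t.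
(* On F the deviation from m is at least m / 2. *)
rewrite indicE; case: (boolP (t \in F)) => [/set_mem Ft|_] /=.
  rewrite mulrAC ler_pdivlMr ?exprn_gt0 // mul1r.
  by move: Ft; rewrite /F /=; move: (X t) => y; nra.
by rewrite mulr_ge0 ?sqr_ge0 // divr_ge0 ?sqr_ge0.
Qed.

(** The mean of the partial sums tends to infinity because the probabilities are
    at least delta, so that the probability for all the partial sums to stay below
    M is at most 4 / m for arbitrarily large m. *)
Lemma ae_weighted_count_diverges (A : nat -> set T) (r : nat -> R) (delta : R) :
  (forall k, measurable (A k)) -> (forall k, 0 <= r k <= 1) ->
  (forall k l, k != l -> P (A k `&` A l) = (P (A k) * P (A l))%E) ->
  0 < delta -> (forall k, (delta%:E <= P (A k))%E) -> diverges r ->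
  {ae P, forall t, diverges (fun k => r k * \1_(A k) t)}.
Proof.
move=> mA r01 ind d0 dP div.
pose X n t := \sum_(0 <= k < n) r k * \1_(A k) t.
suff ae_M (M : nat) : {ae P, forall t, exists n, M%:R < X n t}.
  have := ae_foralln ae_M; apply: filterS => t HX M.
  have [n Xn] := HX (Num.truncn `|M|).+1; exists n; apply/ltW; apply: lt_trans Xn.
  by apply: le_lt_trans (ler_norm M) _; rewrite truncnS_gt.
pose B := \bigcap_n [set t | X n t <= M%:R].
have mXM n : measurable [set t | X n t <= M%:R].
  have := measurable_weighted_count r n mA => /(_ measurableT `]-oo, M%:R]%classic).
  by rewrite setTI; apply.
have mB : measurable B by exact: bigcapT_measurable.
exists B; split => //; last first.
  by move=> t /= /forallNP Ht n _ /=; rewrite leNgt; apply/negP; exact: Ht.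
suff small eps : 0 < eps -> fine (P B) <= eps.
  apply/eqP; rewrite -[P B]fineK ?fin_num_measure // eqe eq_le fine_ge0 ?measure_ge0 // andbT.
  by apply/ler_addgt0Pr => eps /small; rewrite add0r.
move=> eps0.
(* A mean m >= 2 * M + 4 / eps gives both M <= m / 2 and 4 / m <= eps. *)
have [n rn] := div ((2 * M%:R + 4 / eps) / delta).
pose m := \sum_(0 <= k < n) r k * fine (P (A k)).
have mge : 2 * M%:R + 4 / eps <= m.
  apply: (@le_trans _ _ (\sum_(0 <= k < n) r k * delta)).
    by rewrite -mulr_suml -ler_pdivrMr.
  apply: ler_sum => k _; apply: ler_wpM2l; first by case/andP: (r01 k).
  by rewrite -lee_fin fineK ?fin_num_measure.
have M0 : 0 <= M%:R :> R by rewrite ler0n.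
have e40 : 0 < 4 / eps by rewrite divr_gt0.
have m0 : 0 < m by lra.
have Mm : M%:R <= m / 2 by lra.
apply: (@le_trans _ _ (4 / m)); last first.
  by rewrite ler_pdivrMr // mulrC -ler_pdivrMr //; lra.
apply: le_trans (weighted_count_lower_tail mA r01 ind m0).
have mF : measurable [set t | X n t <= m / 2].
  have := measurable_weighted_count r n mA => /(_ measurableT `]-oo, m / 2]%classic).
  by rewrite setTI; apply.
apply: fine_le; rewrite ?fin_num_measure //.
apply: le_measure; rewrite ?inE // => t /(_ n I) /= XM.
by apply: le_trans XM _.
Qed.

End Events.

Section Labels.
Context (R : realType) d (T : measurableType d) (P : probability T R).
Context (I : choiceType) (D : set I) (U : I -> {RV P >-> R}) (q : R).
Context (iidU : iid_uniform01 D U) (q01 : 0 <= q < 1).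

(** On this event the edges of K are closed at every p <= q simultaneously. *)
Definition closed_at (K : {fset I}) : set T :=
  \bigcap_(e in [set` K]) (U e @^-1` `]q, +oo[).

Lemma measurable_closed_at K : measurable (closed_at K).
Proof.
apply: fin_bigcap_measurable => // e _.
by rewrite -[X in measurable X]setTI; exact: measurable_funPT.
Qed.

Lemma prob_closed_edge e : D e -> P (U e @^-1` `]q, +oo[) = (1 - q)%:E.
Proof.
move=> De; have := iidU.2 e De `]q, +oo[%classic (measurable_itv _).
rewrite /distribution /pushforward => ->.
rewrite /uniform_prob integral_uniform_pdf.
have -> : `]q, +oo[%classic `&` `[0, 1]%classic = `]q, 1]%classic :> set R.
  apply/seteqP; split=> x /=; rewrite !in_itv /= ?andbT.
    by move=> [-> /andP[]].
  by case/andP: q01 => q0 _ /andP[qx ->]; rewrite qx; split=> //; rewrite andbT (le_trans q0) // ltW.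
rewrite (eq_integral (fun=> 1%:E)); last first.
  move=> x; rewrite inE /= in_itv /= /uniform_pdf => /andP[qx ->].
  by rewrite (le_trans _ (ltW qx)) ?subr0 ?invr1 //; case/andP: q01.
rewrite integral_cst //= lebesgue_measure_itv /= lte_fin.
by case/andP: q01 => _ ->; rewrite mul1e EFinB.
Qed.

Lemma prob_closed_at K : [set` K] `<=` D ->
  P (closed_at K) = ((1 - q) ^+ #|` K|)%:E.
Proof.
move=> KD; rewrite /closed_at (iidU.1 K KD (fun=> `]q, +oo[%classic)) //.
rewrite big_seq (eq_bigr (fun=> (1 - q)%:E)); last by move=> e /KD; exact: prob_closed_edge.
rewrite -big_seq prodEFin; congr EFin.
by rewrite big_const_seq count_predT -Monoid.iteropE.
Qed.

Lemma closed_atU K L : closed_at (K `|` L)%fset = closed_at K `&` closed_at L.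
Proof.
rewrite /closed_at -bigcap_setU; congr bigcap; apply/seteqP; split=> e /=.
  by rewrite inE => /orP.
by move=> /orP; rewrite inE.
Qed.

Lemma indep_closed_at K L : [set` K] `<=` D -> [set` L] `<=` D ->
  [disjoint K & L]%fset ->
  P (closed_at K `&` closed_at L) = (P (closed_at K) * P (closed_at L))%E.
Proof.
move=> KD LD KL; rewrite -closed_atU !prob_closed_at //.
  by rewrite -EFinM -exprD cardfsU (eqP KL) cardfs0 subn0.
by move=> e /=; rewrite inE => /orP[/KD|/LD].
Qed.

End Labels.

(** * Barriers built from closed cutsets *)

Section Barriers.
Context (R : realType) (V : choiceType) (adj : rel V).
Context (adjC : symmetric adj) (adjx : irreflexive adj).
Context (lf : forall x, finite_set [set y | adj x y]).
Implicit Types (c : set V -> R) (pi : V -> int).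

(** The end where pi tends to +oo has zero capacity: it can be cut off at
    arbitrarily large heights at an arbitrarily small cost in energy. *)
Definition barrier c pi := forall (m : int) (eps : R), 0 < eps ->
  exists (phi : V -> R) (M : int),
    [/\ forall v, 0 <= phi v <= 1, forall v, pi v <= m -> phi v = 1,
        forall v, M < pi v -> phi v = 0
      & forall B, uniq B -> energy adj c B phi <= eps].

(** The two cut-off functions take values in [0, 1], so the energy of their product
    is at most twice the sum of their energies, while its support lies in a bounded
    range of heights. *)
Lemma recurrent_of_barriers c pi : conductance adj c ->
  (forall m1 m2, finite_set [set v | m1 <= pi v <= m2]) ->
  barrier c pi -> barrier c (fun v => - pi v) -> recurrent adj c.
Proof.
move=> c0 fin bar bar' x w0.
apply: (return_prob_small_energy adjC adjx lf c0) => // eps eps0.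
have eps4 : 0 < eps / 4 by rewrite divr_gt0.
have [phi [M [phi01 phi1 phi0 En]]] := bar (pi x) _ eps4.
have [psi [N [psi01 psi1 psi0 En']]] := bar' (- pi x) _ eps4.
exists (fun v => phi v * psi v), (fset_set [set v | - N <= pi v <= M]); split.
- by rewrite phi1 // psi1 // mulr1.
- move=> y; rewrite in_fset_set //; have [lt1|ge1] := ltP M (pi y).
    by rewrite phi0 // mul0r.
  have [lt2|ge2] := ltP N (- pi y); first by rewrite psi0 // mulr0.
  by move/negP; case; rewrite inE /= ge1 andbT lerNl.
- move=> B uB.
  apply: (@le_trans _ _ (2 * energy adj c B phi + 2 * energy adj c B psi)); last first.
    by have := En B uB; have := En' B uB; lra.
  rewrite /energy !mulr_sumr -big_split; apply: ler_sum => a _ /=.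
  rewrite !mulr_sumr -big_split; apply: ler_sum => b _ /=.
  rewrite !(mulrCA 2) -mulrDr; apply: ler_wpM2l; first exact: edge_weight_ge0.
  have := phi01 b; have := psi01 a.
  move: (phi a) (phi b) (psi a) (psi b) => u1 u2 v1 v2 /andP[v0 v1'] /andP[u0 u1'].
  have -> : u1 * v1 - u2 * v2 = v1 * (u1 - u2) + u2 * (v1 - v2) by ring.
  have sq1 : v1 ^+ 2 <= 1 by rewrite expr_le1.
  have sq2 : u2 ^+ 2 <= 1 by rewrite expr_le1.
  have e1 : 0 <= (1 - v1 ^+ 2) * (u1 - u2) ^+ 2 by rewrite mulr_ge0 ?sqr_ge0 ?subr_ge0.
  have e2 : 0 <= (1 - u2 ^+ 2) * (v1 - v2) ^+ 2 by rewrite mulr_ge0 ?sqr_ge0 ?subr_ge0.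
  have e3 : 0 <= (v1 * (u1 - u2) - u2 * (v1 - v2)) ^+ 2 by exact: sqr_ge0.
  lra.
Qed.

(** Orienting the pair upwards represents each edge of a cutset exactly once. *)
Definition crosses pi (k : int) (e : V * V) :=
  adj e.1 e.2 && (pi e.1 <= k < pi e.2).

Section Height.
Context (pi : V -> int) (L : nat) (L0 : (0 < L)%N).
Context (jump : forall a b, adj a b -> pi b - pi a <= L%:Z).

(** Levels at distance L, a bound on the jumps of the height, are crossed by disjoint
    sets of edges. *)
Definition level (k : nat) : int := (k * L)%N.

Lemma crosses_inj a b k l : crosses pi (level k) (a, b) -> crosses pi (level l) (a, b) ->
  k = l.
Proof.
move=> /andP[/= ab /andP[h1 h2]] /andP[_ /andP[h3 h4]].
have := jump ab; move: h1 h2 h3 h4; rewrite /level; move: (pi a) (pi b) => x y.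
have [kl|lk|//] := ltngtP k l.
  by have := leq_mul kl (leqnn L); rewrite mulSn; lia.
by have := leq_mul lk (leqnn L); rewrite mulSn; lia.
Qed.

Lemma crosses_antisym a b k l : crosses pi (level k) (a, b) -> crosses pi (level l) (b, a) ->
  False.
Proof.
move=> /andP[/= ab /andP[h1 h2]] /andP[_ /andP[/= h3 h4]].
have := lt_trans (le_lt_trans h1 h2) (le_lt_trans h3 h4).
by rewrite ltxx.
Qed.

(** The criterion of Nash-Williams.  The function phi drops by rho k / S across the
    k-th cutset, with S the sum of the rho k involved; an edge crosses at most one
    level, so the energy of phi is at most the sum of the
    2 * (rho k / S) ^+ 2 * C k, with C k the conductance of the k-th cutset.  As
    rho k * C k <= 1 this is at most 2 / S. *)
Lemma barrier_of_resistances c (rho : nat -> R) : conductance adj c ->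
  (forall k, 0 <= rho k) -> diverges rho ->
  (forall k s, uniq s -> all (crosses pi (level k)) s ->
     rho k * \sum_(e <- s) edge_weight adj c e.1 e.2 <= 1) ->
  barrier c pi.
Proof.
move=> c0 rho0 div bnd m eps eps0.
(* Only the levels from k0 on are used: they lie above m, because L >= 1. *)
pose k0 := `|m|%N.
have [n Sn] := div (\sum_(0 <= k < k0) rho k + 2 / eps).
have e20 : 0 < 2 / eps by rewrite divr_gt0.
have k0n : (k0 <= n)%N.
  rewrite leqNgt; apply/negP => nk0.
  have : \sum_(0 <= k < n) rho k <= \sum_(0 <= k < k0) rho k.
    by rewrite [leRHS](@big_cat_nat _ _ _ n) //= 1?ltnW // lerDl sumr_ge0.
  by lra.
pose S := \sum_(k0 <= k < n) rho k.
have split_S : \sum_(0 <= k < n) rho k = \sum_(0 <= k < k0) rho k + S.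
  by rewrite [LHS](@big_cat_nat _ _ _ k0).
have S2 : 2 / eps <= S by move: Sn; rewrite split_S lerD2l.
have S0 : 0 < S by apply: lt_le_trans S2.
pose w k := rho k / S.
have w0 k : 0 <= w k by rewrite divr_ge0 // ltW.
have w1 : \sum_(k0 <= k < n) w k = 1 by rewrite -mulr_suml divff // gt_eqF.
pose phi v := \sum_(k0 <= k < n) w k * (pi v <= level k)%R%:R.
exists phi, (level n); split.
- move=> v; rewrite sumr_ge0 => [|k _]; last by rewrite mulr_ge0.
  by rewrite -w1; apply: ler_sum => k _; rewrite ler_piMr // lern1 leq_b1.
- move=> v vm; rewrite -w1; apply: eq_big_nat => k /andP[k0k _].
  suff -> : pi v <= level k by rewrite mulr1.
  by apply: (le_trans vm); move: k0k; rewrite /level /k0; nia.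
- move=> v nv; rewrite /phi big_nat big1 // => k /andP[_ kn].
  suff -> : pi v <= level k = false by rewrite mulr0.
  by apply/negbTE; rewrite -ltNge; apply: le_lt_trans nv; rewrite /level; nia.
move=> B uB.
pose chi k a b : R := (crosses pi (level k) (a, b))%:R.
have grad a b : adj a b -> (phi a - phi b) ^+ 2 <=
    \sum_(k0 <= k < n) w k ^+ 2 * (chi k a b + chi k b a).
  move=> ab; have ba : adj b a by rewrite adjC.
  have diff : phi a - phi b = \sum_(k0 <= k < n) w k * (chi k a b - chi k b a).
    rewrite -sumrB; apply: eq_bigr => k _; rewrite -mulrBr; congr (_ * _).
    rewrite /chi /crosses /= ab ba /=.
    by case: (leP (pi a)); case: (leP (pi b)) => //= *; rewrite ?subrr ?subr0.
  have [[k [kn kx]]|none] := pselect (exists k, k \in index_iota k0 n /\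
      (crosses pi (level k) (a, b) || crosses pi (level k) (b, a))).
    have other l : l != k -> chi l a b = 0 /\ chi l b a = 0.
      move=> lk; suff : ~~ crosses pi (level l) (a, b) /\ ~~ crosses pi (level l) (b, a).
        by rewrite /chi => -[/negbTE -> /negbTE ->].
      split; apply/negP => lx; case/orP: kx => kx.
      - by rewrite (crosses_inj lx kx) eqxx in lk.
      - exact: crosses_antisym lx kx.
      - exact: crosses_antisym kx lx.
      - by rewrite (crosses_inj lx kx) eqxx in lk.
    rewrite diff (bigD1_seq k) ?iota_uniq //= [X in _ + X]big1; last first.
      by move=> l /other[-> ->]; rewrite subrr mulr0.
    rewrite [leRHS](bigD1_seq k) ?iota_uniq //= [X in _ <= _ + X]big1; last first.
      by move=> l /other[-> ->]; rewrite addr0 mulr0.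
    rewrite !addr0 exprMn ler_wpM2l ?sqr_ge0 // /chi.
    by case: (crosses _ _ _); case: (crosses _ _ _) => /=; lra.
  rewrite diff big_seq big1.
    rewrite expr0n /=; apply: sumr_ge0 => k _.
    by rewrite mulr_ge0 ?sqr_ge0 ?addr_ge0 // /chi ler0n.
  move=> k kn; rewrite /chi; case: (boolP (crosses _ _ _)) => kx.
    by case: none; exists k; rewrite kx.
  case: (boolP (crosses _ _ _)) => kx'.
    by case: none; exists k; rewrite kx' orbT.
  by rewrite subrr mulr0.
have cut k : rho k * (\sum_(a <- B) \sum_(b <- B) edge_weight adj c a b * chi k a b) <= 1.
  pose s := [seq e <- [seq (a, b) | a <- B, b <- B] | crosses pi (level k) e].
  apply: le_trans (bnd k s _ (filter_all _ _)); last first.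
    by rewrite filter_uniq // allpairs_uniq // => -[? ?] [? ?] _ _ /= [-> ->].
  rewrite [X in _ <= _ * X]big_filter [X in _ <= _ * X]big_mkcond [X in _ <= _ * X]big_allpairs /=.
  apply: ler_wpM2l => //; apply: ler_sum => a _; apply: ler_sum => b _.
  by rewrite /chi; case: ifP; rewrite ?mulr1 ?mulr0.
apply: (@le_trans _ _ (\sum_(a <- B) \sum_(b <- B) \sum_(k0 <= k < n)
    edge_weight adj c a b * (w k ^+ 2 * (chi k a b + chi k b a)))).
  apply: ler_sum => a _; apply: ler_sum => b _; rewrite -mulr_sumr.
  case: (boolP (adj a b)) => ab.
    by apply: ler_wpM2l; [exact: edge_weight_ge0|exact: grad].
  by rewrite /edge_weight (negbTE ab) !mul0r.
have -> : \sum_(a <- B) \sum_(b <- B) \sum_(k0 <= k < n)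
    edge_weight adj c a b * (w k ^+ 2 * (chi k a b + chi k b a)) =
  \sum_(k0 <= k < n) w k ^+ 2 *
    (2 * \sum_(a <- B) \sum_(b <- B) edge_weight adj c a b * chi k a b).
  under eq_bigr do rewrite exchange_big.
  rewrite exchange_big; apply: eq_bigr => k _ /=.
  have -> : 2 * (\sum_(a <- B) \sum_(b <- B) edge_weight adj c a b * chi k a b) =
      \sum_(a <- B) \sum_(b <- B) edge_weight adj c a b * chi k a b +
      \sum_(a <- B) \sum_(b <- B) edge_weight adj c a b * chi k b a.
    rewrite mulr_natl mulr2n; congr (_ + _); rewrite exchange_big.
    by apply: eq_bigr => b _; apply: eq_bigr => a _; rewrite edge_weightC.
  rewrite -big_split mulr_sumr; apply: eq_bigr => a _.
  by rewrite -big_split mulr_sumr; apply: eq_bigr => b _ /=; ring.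
apply: (@le_trans _ _ (\sum_(k0 <= k < n) 2 / S * w k)).
  apply: ler_sum => k _; have := cut k; set C := \sum_(a <- B) _ => kC.
  rewrite (_ : w k ^+ 2 * (2 * C) = 2 / S * w k * (rho k * C)); last by rewrite /w; ring.
  by rewrite ler_piMr // mulr_ge0 // divr_ge0 // ltW.
by rewrite -mulr_sumr w1 mulr1 ler_pdivrMr // mulrC -ler_pdivrMr.
Qed.

End Height.
End Barriers.

(** * Recurrence of disordered networks *)

Lemma set2_eqP (V : eqType) (a b a' b' : V) :
  [set a; b]%classic = [set a'; b']%classic -> (a = a' /\ b = b') \/ (a = b' /\ b = a').
Proof.
move=> E.
have h1 : [set a'; b']%classic a by rewrite -E; left.
have h2 : [set a'; b']%classic b by rewrite -E; right.
have h3 : [set a; b]%classic a' by rewrite E; left.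
have h4 : [set a; b]%classic b' by rewrite E; right.
by move: h1 h2 h3 h4 => /= [->|->] [->|->] [?|?] [?|?]; subst; tauto.
Qed.

Section Disorder.
Context (R : realType) d (T : measurableType d) (P : probability T R).
Context (V : choiceType) (adj : rel V).
Context (adjC : symmetric adj) (adjx : irreflexive adj).
Context (c1 c2 : set V -> R) (U : set V -> {RV P >-> R}).
Context (c10 : conductance adj c1) (c20 : conductance adj c2).
Context (iidU : iid_uniform01 (edges adj) U).

Lemma disordered_conductance p t : conductance adj (disordered U c1 c2 p t).
Proof. by move=> e He; rewrite /disordered; case: ifP => _; [exact: c10|exact: c20]. Qed.

(** A bound on the size of the cutsets that is uniform in the level; a covering
    list spares the exact enumeration of the edges. *)
Definition cuts_covered (pi : V -> int) (K : nat) := forall k : int,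
  exists s : seq (V * V), (size s <= K)%N /\ forall e, crosses adj pi k e -> e \in s.

(** For a fixed q, the cutsets all of whose labels exceed q are closed at every
    p <= q, so on them the disordered conductance is c2.  Each one occurs with
    probability at least (1 - q) ^+ K, independently of the others since disjoint
    cutsets involve different labels; hence they carry a divergent part of the
    series almost surely.  The levels q = 1 - 1 / (j + 1) exhaust all p < 1. *)
Lemma ae_barrier (pi : V -> int) (L K : nat) (b : nat -> R) : (0 < L)%N ->
  (forall x y, adj x y -> pi y - pi x <= L%:Z) -> cuts_covered pi K ->
  (forall k, 0 <= b k) ->
  (forall k s, uniq s -> all (crosses adj pi (level L k)) s ->
    \sum_(e <- s) edge_weight adj c2 e.1 e.2 <= b k) ->
  diverges (fun k => (1 + b k)^-1) ->
  {ae P, forall t, forall p, 0 <= p < 1 -> barrier adj (disordered U c1 c2 p t) pi}.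
Proof.
move=> L0 jump cov b0 bnd div.
have /choice[cut cutP] : forall k, exists s : seq (V * V),
    (size s <= K)%N /\ forall e, (e \in s) = crosses adj pi (level L k) e.
  move=> k; have [s [sK sc]] := cov (level L k).
  exists [seq e <- s | crosses adj pi (level L k) e]; split.
    by rewrite size_filter (leq_trans (count_size _ _)).
  move=> e; rewrite mem_filter; case: (boolP (crosses _ _ _ _)) => //= /sc.
  by [].
pose E k : {fset set V} := [fset x in [seq [set e.1; e.2] | e <- cut k]]%fset.
have memE k x : x \in E k -> exists e, crosses adj pi (level L k) e /\ x = [set e.1; e.2].
  by rewrite inE => /mapP[e]; rewrite (cutP k).2 => ? ->; exists e.
have crosses_mem k e : crosses adj pi (level L k) e -> [set e.1; e.2] \in E k.
  by move=> ek; rewrite inE; apply/mapP; exists e => //; rewrite (cutP k).2.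
have Eedges k : [set` E k] `<=` edges adj.
  by move=> x /= /memE[[u v] [/andP[/= uv _] ->]]; exists (u, v).
have Edisj k l : k != l -> [disjoint E k & E l]%fset.
  move=> kl; apply/fdisjointP => x /memE[[u v] [ke ->]]; apply/negP => /memE[[u' v'] [le /= /set2_eqP]].
  case=> -[? ?]; subst; first by rewrite (crosses_inj L0 jump ke le) eqxx in kl.
  exact: crosses_antisym ke le.
have Ecard k : (#|` E k| <= K)%N.
  apply: leq_trans (cutP k).1.
  rewrite -(size_map (fun e => [set e.1; e.2]) (cut k)).
  by apply: uniq_leq_size; [exact: fset_uniq|move=> x; rewrite inE].
pose q (j : nat) : R := 1 - j.+1%:R^-1.
have q01 j : 0 <= q j < 1.
  rewrite /q subr_ge0 invf_le1 ?ltr0n // ler1n /=.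
  by rewrite ltrBlDr ltrDl invr_gt0 ltr0n.
have r01 k : 0 <= (1 + b k)^-1 <= 1.
  by rewrite invr_ge0 addr_ge0 //= invf_le1 ?lerDl // ltr_wpDr.
have ae_q j : {ae P, forall t,
    diverges (fun k => (1 + b k)^-1 * \1_(closed_at U (q j) (E k)) t)}.
  apply: (@ae_weighted_count_diverges _ _ _ P _ _ ((1 - q j) ^+ K)) => //.
  - by move=> k; exact: measurable_closed_at.
  - by move=> k l /Edisj kl; apply: (indep_closed_at iidU (q01 j)).
  - by rewrite exprn_gt0 // subr_gt0; case/andP: (q01 j).
  - move=> k; rewrite (prob_closed_at iidU (q01 j)) // lee_fin.
    by case/andP: (q01 j) => q0 q1; rewrite ler_wiXn2l // ?subr_ge0 ?gerBl // ltW.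
have := ae_foralln ae_q; apply: filterS => t Ht p /andP[p0 p1].
have [j pj] : exists j, p <= q j.
  exists (Num.truncn (1 - p)^-1); rewrite /q lerBrDr -lerBrDl.
  rewrite -[leRHS]invrK lef_pV2 ?posrE ?invr_gt0 ?subr_gt0 ?ltr0n //.
  by apply/ltW; exact: truncnS_gt.
apply: (barrier_of_resistances adjC L0 jump (disordered_conductance p t) _ (Ht j)).
  by move=> k; rewrite mulr_ge0 //; case/andP: (r01 k).
move=> k s us sc; rewrite indicE; case: (boolP (t \in _)) => [/set_mem tA|_]; last first.
  by rewrite mulr0 mul0r.
rewrite mulr1 mulrC ler_pdivrMr ?mul1r; last by rewrite ltr_wpDr.
apply: (@le_trans _ _ (b k)); last by rewrite lerDr.
apply: le_trans (bnd k s us sc); rewrite le_eqVlt; apply/orP; left; apply/eqP.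
apply: eq_big_seq => e es; rewrite /edge_weight; case: ifP => // _.
rewrite /disordered ifF //; apply/negbTE; rewrite -ltNge.
have := tA _ (crosses_mem k e (allP sc e es)); rewrite /= in_itv /= andbT.
exact: le_lt_trans.
Qed.

(** The two ends of the graph are those of the heights pi and - pi, which are cut
    off separately since their cutsets may have unrelated conductances. *)
Lemma ae_recurrent (pi pi' : V -> int) (L K : nat) (b b' : nat -> R) :
  (forall x, finite_set [set y | adj x y]) ->
  (forall m1 m2, finite_set [set v | m1 <= pi v <= m2]) ->
  (forall v, pi' v = - pi v) -> (0 < L)%N ->
  (forall x y, adj x y -> pi y - pi x <= L%:Z) ->
  cuts_covered pi K -> cuts_covered pi' K ->
  (forall k, 0 <= b k) -> (forall k, 0 <= b' k) ->
  (forall k s, uniq s -> all (crosses adj pi (level L k)) s ->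
    \sum_(e <- s) edge_weight adj c2 e.1 e.2 <= b k) ->
  (forall k s, uniq s -> all (crosses adj pi' (level L k)) s ->
    \sum_(e <- s) edge_weight adj c2 e.1 e.2 <= b' k) ->
  diverges (fun k => (1 + b k)^-1) -> diverges (fun k => (1 + b' k)^-1) ->
  {ae P, forall t, forall p, 0 <= p < 1 -> recurrent adj (disordered U c1 c2 p t)}.
Proof.
move=> lf fin piN L0 jump cov cov' b0 b'0 bnd bnd' div div'.
have jump' x y : adj x y -> pi' y - pi' x <= L%:Z.
  by move=> xy; rewrite !piN opprK addrC jump // adjC.
have := ae_barrier L0 jump' cov' b'0 bnd' div'.
have := ae_barrier L0 jump cov b0 bnd div.
apply: filterS2 => t bar bar' p p01.
apply: (recurrent_of_barriers adjC adjx lf (disordered_conductance p t) fin (bar p p01)).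
by have := bar' p p01; rewrite (_ : pi' = fun v => - pi v) //; apply/funext.
Qed.

End Disorder.

(** * The line and its products with finite graphs *)

Lemma finite_int_interval (m1 m2 : int) : finite_set [set k : int | m1 <= k <= m2].
Proof.
apply: (@sub_finite_set _ _ [set m1 + i%:Z | i in `I_(`|m2 - m1|%N.+1)]).
  by move=> k /= /andP[h1 h2]; exists `|k - m1|%N => /=; lia.
exact/finite_image/finite_II.
Qed.

Lemma diverges_le (R : realType) (a : R) (r r' : nat -> R) : 0 < a ->
  (forall k, a * r k <= r' k) -> diverges r -> diverges r'.
Proof.
move=> a0 rr' div M; have [n Mn] := div (M / a); exists n.
apply: (@le_trans _ _ (\sum_(0 <= k < n) a * r k)); last exact: ler_sum.
by rewrite -mulr_sumr mulrC -ler_pdivrMr.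
Qed.

Lemma diverges_cst (R : realType) (a : R) : 0 < a -> diverges (fun=> a).
Proof.
move=> a0 M; exists (Num.truncn (M / a)).+1.
rewrite big_const_nat subn0 iter_addr_0 -mulr_natl -ler_pdivrMr //.
by apply/ltW; exact: truncnS_gt.
Qed.

Lemma line_crossing (sg k x y : int) : sg * sg = 1 -> line_adj x y ->
  sg * x <= k < sg * y -> x = sg * k /\ y = sg * (k + 1).
Proof.
by move=> /sg_cases [] ->; rewrite line_adjE => /orP[] /eqP ->; lia.
Qed.

Lemma line_jump (sg x y : int) : sg * sg = 1 -> line_adj x y -> sg * y - sg * x <= 1.
Proof.
by move=> /sg_cases [] ->; rewrite line_adjE => /orP[] /eqP ->; lia.
Qed.

Section LineProducts.
Context (R : realType) (W : finType) (g : rel W).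
Context (gC : symmetric g) (gx : irreflexive g).

Local Notation padj := (cartesian_adj line_adj g).

Lemma cartesianC : symmetric padj.
Proof.
move=> [x w] [y v]; rewrite /cartesian_adj /= gC (line_adjC x y).
by rewrite (eq_sym w v) (eq_sym x y).
Qed.

Lemma cartesianx : irreflexive padj.
Proof. by move=> [x w]; rewrite /cartesian_adj /= line_adjx gx !andbF. Qed.

Lemma cartesian_finite u : finite_set [set v | padj u v].
Proof.
apply: (@sub_finite_set _ _ ([set y | u.1 - 1 <= y <= u.1 + 1] `*` [set: W])).
  move=> [y v] /orP[] /andP[] /=.
    by rewrite line_adjE => /orP[] /eqP -> _; split => //=; lia.
  by move=> /eqP <- _; split => //=; lia.
by apply: finite_setX; [exact: finite_int_interval|exact: finite_finset].
Qed.

Context (sg : int) (sg1 : sg * sg = 1).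

(** The only edge over w that crosses the level k. *)
Definition rung k w : (int * W) * (int * W) := ((sg * k, w), (sg * (k + 1), w)).

Lemma cartesian_crossing k e : crosses padj (fun v => sg * v.1) k e ->
  e \in [seq rung k w | w <- enum W].
Proof.
case: e => [[x w] [y v]] /andP[/= /orP[] /andP[/=]].
  move=> xy /eqP <- /(line_crossing sg1 xy)[-> ->].
  by apply/mapP; exists w => //; rewrite mem_enum.
by move=> /eqP <- _ /andP[h1 h2]; have := le_lt_trans h1 h2; rewrite ltxx.
Qed.

Lemma rung_conductance (c : set (int * W) -> R) k w :
  edge_weight padj c (rung k w).1 (rung k w).2 =
  c [set (x, w) | x in [set sg * k; sg * (k + 1)]].
Proof.
by rewrite /edge_weight /cartesian_adj /= ray_adj // eqxx /= image_setU !image_set1.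
Qed.

Lemma cartesian_cuts : cuts_covered padj (fun v => sg * v.1) #|W|.
Proof.
move=> k; exists [seq rung k w | w <- enum W]; split; first by rewrite size_map -cardE.
exact: cartesian_crossing.
Qed.

Lemma cartesian_jump u v : padj u v -> sg * v.1 - sg * u.1 <= 1%N%:Z.
Proof.
case/orP => /andP[]; first by move=> uv _; exact: line_jump.
by move=> /eqP -> _; rewrite subrr.
Qed.

Context (c : set (int * W) -> R) (c0 : conductance padj c).

Lemma max_projection_ge0 e : 0 <= max_projection c e.
Proof. by apply: bigmax_ge_id. Qed.

(** All the edges that cross a given level are horizontal, one over each vertex of
    W. *)
Lemma cartesian_cut_conductance k s : uniq s ->
  all (crosses padj (fun v => sg * v.1) (level 1 k)) s ->
  \sum_(e <- s) edge_weight padj c e.1 e.2 <=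
  #|W|%:R * ray_conductance (max_projection c) sg k.
Proof.
move=> us /allP sc; pose t := [seq rung k%:Z w | w <- enum W].
apply: (@le_trans _ _ (\sum_(e <- t) edge_weight padj c e.1 e.2)).
  apply: ler_sum_uniq_sub => // [e es|e]; last exact: edge_weight_ge0.
  by apply: cartesian_crossing; have := sc e es; rewrite /level muln1.
apply: (@le_trans _ _ (\sum_(w <- enum W) ray_conductance (max_projection c) sg k)).
  rewrite big_map; apply: ler_sum => w _; rewrite rung_conductance /ray_conductance.
  exact: (le_bigmax 0 (fun v => c [set (x, v) | x in [set sg * k%:Z; sg * (k%:Z + 1)]])).
by rewrite big_const_seq count_predT iter_addr_0 -cardE mulr_natl.
Qed.

Lemma cartesian_cut_diverges : recurrent line_adj (max_projection c) ->
  diverges (fun k => (1 + #|W|%:R * ray_conductance (max_projection c) sg k)^-1).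
Proof.
move=> rec; have r0 := ray_conductance_ge0 (fun e _ => max_projection_ge0 e) sg1.
have W0 : 0 < 1 + #|W|%:R :> R by rewrite ltr_wpDr.
have := recurrent_ray_diverges (fun e _ => max_projection_ge0 e) sg1 rec.
apply: (@diverges_le _ (1 + #|W|%:R)^-1); first by rewrite invr_gt0.
move=> k; rewrite -invfM lef_pV2 ?posrE ?mulr_gt0 ?ltr_wpDr ?mulr_ge0 //.
by have := r0 k; have : 0 <= #|W|%:R :> R by []; move: (_ k) (_%:R) => u v; nra.
Qed.

End LineProducts.

Lemma ae_recurrent_line (R : realType) d (T : measurableType d) (P : probability T R)
    (c1 c2 : set int -> R) (U : set int -> {RV P >-> R}) :
  conductance line_adj c1 -> conductance line_adj c2 ->
  iid_uniform01 (edges line_adj) U -> recurrent line_adj c2 ->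
  {ae P, forall t, forall p : R, 0 <= p < 1 ->
    recurrent line_adj (disordered U c1 c2 p t)}.
Proof.
move=> c10 c20 iidU rec.
have cross sg k e : sg * sg = 1 -> crosses line_adj ( *%R sg) k e ->
    e = (sg * k, sg * (k + 1)).
  by move=> sg1; case: e => x y /andP[/= xy /(line_crossing sg1 xy)[-> ->]].
have cov sg : sg * sg = 1 -> cuts_covered line_adj ( *%R sg) 1.
  move=> sg1 k; exists [:: (sg * k, sg * (k + 1))]; split=> // e /(cross _ _ _ sg1) ->.
  by rewrite inE.
have bnd sg k s : sg * sg = 1 -> uniq s -> all (crosses line_adj ( *%R sg) (level 1 k)) s ->
    \sum_(e <- s) edge_weight line_adj c2 e.1 e.2 <= ray_conductance c2 sg k.
  move=> sg1 us /allP sc; pose t := [:: (sg * k%:Z, sg * (k%:Z + 1))].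
  apply: (@le_trans _ _ (\sum_(e <- t) edge_weight line_adj c2 e.1 e.2)).
    apply: ler_sum_uniq_sub => // [e es|e]; last exact: edge_weight_ge0.
    by have := cross _ _ _ sg1 (sc e es); rewrite /level muln1 inE => ->.
  by rewrite big_seq1 edge_weight_ray.
apply: (@ae_recurrent _ _ _ P _ _ line_adjC line_adjx _ _ _ c10 c20 iidU
  ( *%R 1) ( *%R (-1)) 1 1 (ray_conductance c2 1) (ray_conductance c2 (-1))).
- exact: line_finite.
- by move=> m1 m2; under eq_set do rewrite mul1r; exact: finite_int_interval.
- by move=> v; rewrite mul1r mulN1r.
- by [].
- by move=> x y; exact: line_jump.
- exact: cov.
- exact: cov.
- exact: ray_conductance_ge0.
- exact: ray_conductance_ge0.
- by move=> k s; exact: bnd.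
- by move=> k s; exact: bnd.
- exact: recurrent_ray_diverges.
- exact: recurrent_ray_diverges.
Qed.

Lemma ae_recurrent_cartesian (R : realType) d (T : measurableType d) (P : probability T R)
    (W : finType) (g : rel W) (c1 c2 : set (int * W) -> R)
    (U : set (int * W) -> {RV P >-> R}) :
  symmetric g -> irreflexive g ->
  let adj := cartesian_adj line_adj g in
  conductance adj c1 -> conductance adj c2 -> iid_uniform01 (edges adj) U ->
  recurrent line_adj (max_projection c2) ->
  {ae P, forall t, forall p : R, 0 <= p < 1 ->
    recurrent adj (disordered U c1 c2 p t)}.
Proof.
move=> gC gx adj c10 c20 iidU rec.
apply: (@ae_recurrent _ _ _ P _ _ (cartesianC gC) (cartesianx gx) _ _ _ c10 c20 iidU
  (fun v => 1 * v.1) (fun v => (-1) * v.1) 1 #|W|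
  (fun k => #|W|%:R * ray_conductance (max_projection c2) 1 k)
  (fun k => #|W|%:R * ray_conductance (max_projection c2) (-1) k)).
- exact: cartesian_finite.
- move=> m1 m2; apply: (@sub_finite_set _ _ ([set y | m1 <= y <= m2] `*` [set: W])).
    by move=> [y w] /=; rewrite mul1r.
  by apply: finite_setX; [exact: finite_int_interval|exact: finite_finset].
- by move=> v; rewrite mul1r mulN1r.
- by [].
- by move=> u v; exact: cartesian_jump.
- exact: cartesian_cuts.
- exact: cartesian_cuts.
- by move=> k; rewrite mulr_ge0 // max_projection_ge0.
- by move=> k; rewrite mulr_ge0 // max_projection_ge0.
- by move=> k s; exact: cartesian_cut_conductance.
- by move=> k s; exact: cartesian_cut_conductance.
- exact: cartesian_cut_diverges.
- exact: cartesian_cut_diverges.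
Qed.

(** * Groups with an infinite cyclic subgroup of finite index *)

Section VirtuallyZ.
Context (G : groupType) (S : seq G).
Local Open Scope group_scope.

Local Notation adj := (cayley_adj S).

Definition steps := S ++ [seq x^-1 | x <- S].

Lemma cayley_adjC : symmetric adj.
Proof. by move=> x y; rewrite /cayley_adj eq_sym orbC. Qed.

Lemma cayley_adjx : irreflexive adj.
Proof. by move=> x; rewrite /cayley_adj eqxx. Qed.

Lemma cayley_step x y : adj x y -> exists2 s, s \in steps & y = x * s.
Proof.
move=> /andP[_ /orP[] xyS]; exists (x^-1 * y); rewrite ?mulVKg // mem_cat ?xyS //.
apply/orP; right; apply/mapP; exists (y^-1 * x) => //.
by rewrite invgM invgK.
Qed.

Lemma cayley_finite x : finite_set [set y | adj x y].
Proof.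
apply: (@sub_finite_set _ _ [set` [seq x * s | s <- steps]]); last exact: finite_seq.
by move=> y /= /cayley_step[s sS ->]; apply/mapP; exists s.
Qed.

(** Each element of the finite list l has at most one preimage. *)
Lemma injective_bounded_on_seq (phi : int -> G) (l : seq G) : injective phi ->
  exists L : nat, (0 < L)%N /\ forall n, phi n \in l -> (`|n| <= L)%N.
Proof.
move=> inj; elim: l => [|g l [L [L0 HL]]]; first by exists 1%N.
have [[m mg]|none] := pselect (exists m, phi m = g).
  exists (maxn L `|m|); split; first by rewrite leq_max L0.
  move=> n; rewrite inE leq_max => /orP[/eqP ng|/HL -> //].
  by rewrite (inj n m) ?leqnn ?orbT // ng mg.
exists L; split=> // n; rewrite inE => /orP[/eqP ng|/HL //].
by case: none; exists n.
Qed.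

(** Inverting all elements turns the finitely many left cosets of the definition
    into right cosets, which are compatible with a Cayley graph whose edges are
    right multiplications: the height below then has bounded jumps. *)
Lemma virtually_Z_representatives : virtually_Z G ->
  exists (phi : int -> G) (rs : seq G),
    [/\ injective phi, forall m n, phi (m + n)%R = phi m * phi n
      & forall x, exists n, exists2 r, r \in rs & x = phi n * r].
Proof.
move=> [phi [inj fin]].
have phiD (m n : int) : phi (m + n)%R = phi m * phi n by exact: (@gmulfM _ _ phi m n).
have phi0 : phi 0%R = 1 by apply: (@mulgI _ (phi 0%R)); rewrite -phiD addr0 mulg1.
have phiN (n : int) : phi (- n)%R = (phi n)^-1.
  by apply: (@mulgI _ (phi n)); rewrite -phiD subrr phi0 mulgV.
pose coset (x : G) := [set x * phi n | n in setT].
pose rep (C : set G) := xget 1 [set x | C = coset x].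
exists phi, [seq (rep C)^-1 | C <- fset_set [set coset x | x in setT]]; split=> // x.
have Cx : coset x^-1 = coset (rep (coset x^-1)).
  exact: (@xgetPex _ 1 [set y | coset x^-1 = coset y] (ex_intro _ x^-1 erefl)).
have [n _ nE] : coset (rep (coset x^-1)) x^-1.
  by rewrite -Cx; exists (0%R : int) => //; rewrite phi0 mulg1.
exists (- (n : int))%R; exists (rep (coset x^-1))^-1.
  by apply: map_f; rewrite in_fset_set // inE; exists x^-1.
by rewrite phiN -invgM nE invgK.
Qed.

(** If x = phi m * r and y = x * s = phi n * r' then phi (n - m) = r * s * r'^-1
    ranges over a finite set, so n - m is bounded by injectivity of phi. *)
Lemma virtually_Z_height : virtually_Z G ->
  exists (phi : int -> G) (pi : G -> int) (rs : seq G) (L : nat),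
  [/\ (0 < L)%N, forall x, exists2 r, r \in rs & x = phi (pi x) * r
    & forall x y, adj x y -> (pi y - pi x <= L%:Z)%R].
Proof.
move=> /virtually_Z_representatives[phi [rs [inj phiD rsP]]].
have /choice[pi piP] := rsP.
pose l := [seq u * v | u <- [seq r * s | r <- rs, s <- steps], v <- [seq r^-1 | r <- rs]].
have [L [L0 HL]] := injective_bounded_on_seq l inj.
exists phi, pi, rs, L; split=> // x y /cayley_step[s sS yE].
have [r rrs xE] := piP x; have [r' r'rs yE'] := piP y.
suff /HL : phi (pi y - pi x)%R \in l by lia.
apply/allpairsP; exists (r * s, r'^-1); split => /=.
- by apply/allpairsP; exists (r, s).
- exact: map_f.
apply: (@mulgI _ (phi (pi x))); rewrite -phiD addrC subrK.
by apply: (@mulIg _ r'); rewrite !mulgA mulgVK -yE' -xE.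
Qed.

(** The lower end x of an edge crossing the level k has its height among the L
    integers up to k, and the edge is determined by x and a generator. *)
Lemma group_cuts (phi : int -> G) (pi : G -> int) (rs : seq G) (L : nat) :
  (forall x, exists2 r, r \in rs & x = phi (pi x) * r) ->
  (forall x y, adj x y -> (pi y - pi x <= L%:Z)%R) ->
  cuts_covered adj pi (L * size rs * size steps).
Proof.
move=> piP jump k.
pose A := [seq phi (k - j%:Z)%R * r | j <- iota 0 L, r <- rs].
exists [seq (x, x * s) | x <- A, s <- steps]; split.
  by rewrite !size_allpairs size_iota.
move=> [x y] /andP[/= xy /andP[xk ky]].
have [s sS ->] := cayley_step xy.
apply/allpairsP; exists (x, s); split=> //=.
have [r rrs xE] := piP x.
apply/allpairsP; exists (`|k - pi x|%N, r); split=> //=.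
  by rewrite mem_iota /=; have := jump x y xy; lia.
by rewrite (_ : (k - _)%R = pi x) //; lia.
Qed.

End VirtuallyZ.

(** The cutsets have bounded size and c2 is bounded, so the series to be tested has
    constant positive terms. *)
Lemma ae_recurrent_virtually_Z (R : realType) d (T : measurableType d)
    (P : probability T R) (G : groupType) (S : seq G)
    (c1 c2 : set G -> R) (U : set G -> {RV P >-> R}) :
  virtually_Z G ->
  let adj := cayley_adj S in
  conductance adj c1 -> conductance adj c2 -> iid_uniform01 (edges adj) U ->
  (ereal_sup [set (c2 e)%:E | e in edges adj] < +oo)%E ->
  {ae P, forall t, forall p : R, 0 <= p < 1 ->
    recurrent adj (disordered U c1 c2 p t)}.
Proof.
move=> vZ adj c10 c20 iidU supc.
have [M [M0 c2M]] : exists M : R, 0 <= M /\ forall e, edges adj e -> c2 e <= M.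
  exists `|fine (ereal_sup [set (c2 e)%:E | e in edges adj])|; split=> // e He.
  apply: le_trans (ler_norm _).
  have le_sup : ((c2 e)%:E <= ereal_sup [set (c2 e)%:E | e in edges adj])%E.
    by apply: ereal_sup_ubound; exists e.
  rewrite -lee_fin fineK // fin_numE gt_eqF ?lt_eqF //.
  by apply: lt_le_trans le_sup; rewrite ltNyr.
have [phi [pi [rs [L [L0 piP jump]]]]] := virtually_Z_height S vZ.
pose K := (L * size rs * size (steps S))%N.
have cov : cuts_covered adj pi K by exact: group_cuts piP jump.
have cov' : cuts_covered adj (fun v => - pi v) K.
  apply: (@group_cuts _ _ (fun n => phi (- n))) => [x|x y xy]; first by rewrite opprK.
  by rewrite opprK addrC jump // cayley_adjC.
have bnd pi' k s : cuts_covered adj pi' K -> uniq s -> all (crosses adj pi' k) s ->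
    \sum_(e <- s) edge_weight adj c2 e.1 e.2 <= K%:R * M.
  move=> cvd us /allP sc; have [t [tK tc]] := cvd k.
  have sK : (size s <= K)%N.
    by apply: leq_trans tK; apply: uniq_leq_size => // e /sc /tc.
  apply: (@le_trans _ _ (\sum_(e <- s) M)).
    rewrite !big_seq; apply: ler_sum => e /sc /andP[ee _].
    by rewrite /edge_weight ee; apply: c2M; exists e.
  by rewrite big_const_seq count_predT iter_addr_0 -[leLHS]mulr_natl ler_wpM2r // ler_nat.
have KM0 : 0 <= K%:R * M by rewrite mulr_ge0.
have div : diverges (fun k : nat => (1 + K%:R * M)^-1).
  by apply: diverges_cst; rewrite invr_gt0 ltr_wpDr.
apply: (@ae_recurrent _ _ _ P _ _ (@cayley_adjC _ S) (@cayley_adjx _ S) _ _ _ c10 c20 iidU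
  pi (fun v => - pi v) L K (fun=> K%:R * M) (fun=> K%:R * M)) => //.
- exact: cayley_finite.
- move=> m1 m2; apply: (@sub_finite_set _ _
    [set (phi n * r)%g | n in [set n | m1 <= n <= m2] & r in [set` rs]]).
    move=> v /= mv; have [r rrs vE] := piP v.
    by exists (pi v) => //; exists r.
  by apply: finite_image2; [exact: finite_int_interval|exact: finite_seq].
- by move=> k s; exact: bnd.
- by move=> k s; exact: bnd.
Qed.

Lemma virtually_Z_int : virtually_Z (Algebra.to_multiplicative int).
Proof.
exists idfun; split=> //.
apply: (@sub_finite_set _ _ [set setT]); last exact: finite_set1.
move=> C [x _ <-] /=; apply/seteqP; split=> // y _.
by exists (x^-1 * y)%g => //=; rewrite mulVKg.
Qed.

(** * The four families of disordered networks *)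

Theorem theorem2p3 (R : realType) (d : measure_display) (T : measurableType d)
    (P : probability T R) :
  (* (i) *)
  (forall (c1 c2 : set int -> R) (U : set int -> {RV P >-> R}),
     conductance line_adj c1 -> conductance line_adj c2 ->
     iid_uniform01 (edges line_adj) U ->
     recurrent line_adj c2 ->
     {ae P, forall t, forall p : R, 0 <= p < 1 ->
       recurrent line_adj (disordered U c1 c2 p t)}) /\
  (* (ii) *)
  (forall (S : seq (Algebra.to_multiplicative int))
      (c1 c2 : set (Algebra.to_multiplicative int) -> R)
      (U : set (Algebra.to_multiplicative int) -> {RV P >-> R}),
     generates S ->
     let adj := cayley_adj S in
     conductance adj c1 -> conductance adj c2 ->
     iid_uniform01 (edges adj) U ->
     (ereal_sup [set (c2 e)%:E | e in edges adj] < +oo)%E ->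
     {ae P, forall t, forall p : R, 0 <= p < 1 ->
       recurrent adj (disordered U c1 c2 p t)}) /\
  (* (iii) *)
  (forall (W : finType) (g : rel W)
      (c1 c2 : set (int * W) -> R) (U : set (int * W) -> {RV P >-> R}),
     symmetric g -> irreflexive g -> (forall v w, connect g v w) ->
     let adj := cartesian_adj line_adj g in
     positive_conductance adj c1 -> positive_conductance adj c2 ->
     connected_network adj c1 -> connected_network adj c2 ->
     iid_uniform01 (edges adj) U ->
     recurrent line_adj (max_projection c2) ->
     {ae P, forall t, forall p : R, 0 <= p < 1 ->
       recurrent adj (disordered U c1 c2 p t)}) /\
  (* (iv) *)
  (forall (G : groupType) (S : seq G)
      (c1 c2 : set G -> R) (U : set G -> {RV P >-> R}),
     virtually_Z G -> generates S ->
     let adj := cayley_adj S in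
     positive_conductance adj c1 -> positive_conductance adj c2 ->
     connected_network adj c1 -> connected_network adj c2 ->
     iid_uniform01 (edges adj) U ->
     (ereal_sup [set (c2 e)%:E | e in edges adj] < +oo)%E ->
     {ae P, forall t, forall p : R, 0 <= p < 1 ->
       recurrent adj (disordered U c1 c2 p t)}).
Proof.
split; [|split; [|split]].
- by move=> c1 c2 U; exact: ae_recurrent_line.
- by move=> S c1 c2 U _; exact: ae_recurrent_virtually_Z virtually_Z_int.
- move=> W g c1 c2 U gC gx _ adj c1p c2p _ _.
  by apply: ae_recurrent_cartesian => // e He; apply/ltW; [exact: c1p|exact: c2p].
- move=> G S c1 c2 U vZ _ adj c1p c2p _ _.
  by apply: ae_recurrent_virtually_Z => // e He; apply/ltW; [exact: c1p|exact: c2p].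
Qed.
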